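(* For each $n\ge1$ let $\mathbf d=\mathbf d_n=(d_1,\dots,d_n)$, $d_i=d_i^{(n)}$, be a graphic sequence of nonnegative integers. Assume that, as $n\to\infty$, $\sum_{i=1}^n d_i=\Theta(n)$ and $\sum_{i=1}^n d_i^2=O(n)$. Then, as $n\to\infty$, the random graphs $\widehat G(n,\mathbf d)$ and $G(n,\mathbf d)$ are contiguous: for every sequence $(\mathcal E_n)$ of sets of simple graphs on $[n]$ with degree sequence $\mathbf d_n$, $$\mathbb P\bigl(\widehat G(n,\mathbf d)\in\mathcal E_n\bigr)\to0\iff\mathbb P\bigl(G(n,\mathbf d)\in\mathcal E_n\bigr)\to0 .$$ In other words, any sequence of events $\mathcal E_n$ that holds with probability tending to $1$ for $\widehat G(n,\mathbf d)$ holds also with probability tending to $1$ for $G(n,\mathbf d)$, and conversely. Here $G(n,\mathbf d)$ is the uniformly random simple graph with degree sequence $\mathbf d$ and $\widehat G(n,\mathbf d)$ is the switched configuration model (with an arbitrary fixed rule for choosing which bad edge to switch).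
   Context: Graphic means that at least one simple graph on $[n]=\{1,\dots,n\}$ has degree sequence $\mathbf d$; in particular $N:=\sum_i d_i$ is even. $\Theta(n)$ means a quantity in $[cn,Cn]$ for some constants $c,C>0$ not depending on $n$. $G(n,\mathbf d)$ is a uniformly random element of the set of simple graphs with vertex set $[n]$ and degree sequence $\mathbf d$. Configuration model: assign $d_i$ half-edges $i_1,\dots,i_{d_i}$ to each vertex $i$, for a total of $N$ half-edges. A configuration is a perfect matching of the half-edges; it projects to a multigraph on $[n]$ by regarding each matched pair $\{i_\alpha,j_\beta\}$ as an edge between $i$ and $j$ (a loop if $i=j$). Let $\Gamma_0$ be a uniformly random configuration. Switched configuration model: an edge (matched pair) of a configuration is bad if it is a loop or is parallel to another edge. Starting from $\Gamma_0$, as long as the current configuration has a bad edge, choose a bad edge $i_\alpha j_\beta$ by some fixed rule (e.g. the first in lexicographic order, or a random one), choose another edge $k_\gamma\ell_\delta$ uniformly at random among all other edges of the current configuration, order its two half-edges $k_\gamma,\ell_\delta$ uniformly at random, and replace the two edges $i_\alpha j_\beta$, $k_\gamma\ell_\delta$ by $i_\alpha\ell_\delta$, $k_\gamma j_\beta$ (a switching). Stop when there are no bad edges; $\widehat G(n,\mathbf d)$ is the simple graph that the final configuration projects to. If the process does not terminate, restart with a new random configuration. *)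

(* Defs.v *)
From mathcomp Require Import all_boot all_order all_algebra.

Set Implicit Arguments.
Unset Strict Implicit.
Unset Printing Implicit Defensive.

(* A simple graph on 'I_n is given by its edge set, a set of 2-subsets. *)
Notation graph n := {set {set 'I_n}}.

Section Combinatorics.
Variables (n : nat) (d : 'I_n -> nat).

Definition simple_graph (G : graph n) : bool := [forall e in G, #|e| == 2].

Definition degree (G : graph n) (i : 'I_n) : nat := #|[set e in G | i \in e]|.

Definition graphs_with_degrees : {set graph n} :=
  [set G | simple_graph G && [forall i, degree G i == d i]].

Definition graphic : Prop := exists G, G \in graphs_with_degrees.

(* The half-edge i_alpha is [Tagged _ alpha], with [tag] equal to i. *)
Definition half_edge : finType := {i : 'I_n & 'I_(d i)}.

Definition configurations : {set {set {set half_edge}}} :=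
  [set C | partition C [set: half_edge] & [forall e in C, #|e| == 2]].

(* The end vertices of an edge; a singleton exactly for loops. *)
Definition ends (e : {set half_edge}) : {set 'I_n} := [set tag x | x in e].

Definition loop (e : {set half_edge}) : bool := #|ends e| == 1.

Definition bad (C : {set {set half_edge}}) (e : {set half_edge}) : bool :=
  (e \in C) && (loop e || [exists f in C, (f != e) && (ends f == ends e)]).

Definition has_bad (C : {set {set half_edge}}) : bool := [exists e, bad C e].

(* The multigraph onto which C projects, forgetting multiplicities; nothing is
   forgotten when C has no bad edge, the only case in which it is used. *)
Definition projection (C : {set {set half_edge}}) : graph n :=
  [set ends e | e in C].

(* Replace the edges ab, kl by al, kb. *)
Definition switch (C : {set {set half_edge}}) (ab kl : half_edge * half_edge) :
    {set {set half_edge}} :=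
  (C :\: [set [set ab.1; ab.2]; [set kl.1; kl.2]])
    :|: [set [set ab.1; kl.2]; [set kl.1; ab.2]].

End Combinatorics.

(* Imported only here because classical_sets shadows finset.partition. *)
From mathcomp Require Import boolp classical_sets reals topology normedtype.
From mathcomp Require Import sequences.
Import Order.TTheory GRing.Theory Num.Theory.
Import numFieldNormedType.Exports.
Local Open Scope ring_scope.

Section SwitchedModel.
Variables (R : realType) (n : nat) (d : 'I_n -> nat).

Definition uniform_prob (E : {set graph n}) : R :=
  #|E :&: graphs_with_degrees d|%:R / #|graphs_with_degrees d|%:R.

(* [rho past C (a, b)] is the conditional probability that the bad edge ab is
   the one to be switched, when the current configuration is C and the earlier
   ones are listed in [past].  Thus the rule may be deterministic or random, and
   may look at the past.  Whether the chosen edge is written ab or ba does not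
   affect the law of the next configuration, as the two half-edges of the other
   edge are put in a uniformly random order. *)
Definition selection_rule : Type :=
  seq {set {set half_edge d}} -> {set {set half_edge d}} ->
  half_edge d * half_edge d -> R.

Definition valid_rule (rho : selection_rule) : Prop :=
  forall past C, C \in configurations d -> has_bad C ->
  [/\ forall ab, 0 <= rho past C ab,
      forall ab, rho past C ab != 0 -> bad C [set ab.1; ab.2]
    & \sum_ab rho past C ab = 1].

Variable rho : selection_rule.

(* Probability that the process, currently at C and having visited [past],
   stops after at most t further switchings at a configuration projecting to a
   graph in E.  The other edge f is uniform among the #|C| - 1 other edges, and
   each of its two orderings kl has probability 1/2. *)
Fixpoint stop_prob_from (t : nat) (past : seq {set {set half_edge d}})
    (C : {set {set half_edge d}}) (E : {set graph n}) : R :=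
  if ~~ has_bad C then (projection C \in E)%:R
  else if t is t'.+1 then
    \sum_ab rho past C ab *
      \sum_(f in C :\ [set ab.1; ab.2]) (#|C|.-1)%:R^-1 *
        \sum_(kl | [set kl.1; kl.2] == f) 2^-1 *
          stop_prob_from t' (rcons past C) (switch C ab kl) E
  else 0.

Definition stop_prob (t : nat) (E : {set graph n}) : R :=
  #|configurations d|%:R^-1 *
    \sum_(C in configurations d) stop_prob_from t [::] C E.

(* Probability that a single run terminates, with its final graph in E. *)
Definition run_prob (E : {set graph n}) : R :=
  limn (fun t => stop_prob t E).

(* Runs are independent and are repeated until one terminates; the r-th term is
   the probability that exactly r runs fail before a run ends in E. *)
Definition switched_prob (E : {set graph n}) : R :=
  limn (series (fun r => (1 - run_prob [set: graph n]) ^+ r * run_prob E)).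

End SwitchedModel.

(* Main.v *)
Require Import Defs.
From mathcomp Require Import all_boot all_order all_algebra all_fingroup.
From mathcomp Require Import zify lra.
From mathcomp Require Import boolp classical_sets reals topology normedtype.
From mathcomp Require Import sequences.
Import Order.TTheory GRing.Theory Num.Theory.
Import numFieldNormedType.Exports.

Set Implicit Arguments.
Unset Strict Implicit.
Unset Printing Implicit Defensive.

(** The simple outcomes of the switching process are compared with a uniform
    configuration from both sides.  Write [N] for the number of half-edges, [D2]
    for the sum of the squared degrees, both of order [n].

    One side is immediate.  A run that starts at a simple configuration stops at
    once, and a uniform configuration conditioned to be simple projects onto a
    uniform graph, since every graph with the given degrees is the projection of
    equally many simple configurations ([simple_projection_uniform]).  So the
    process hits [E] with probability at least P(simple) * P(G in E).

    For the other side, call a switching good if the two new edges are not bad.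
    A good switching of a bad edge lowers the number of bad edges, and as long as
    that number is bounded, all but a fraction o(1) of the switchings are good
    ([few_bad_switchings]).  The mean number of bad edges of a uniform
    configuration is bounded ([mean_bad_edges]), so up to probability eps a run
    stops after at most [K] steps, all of them good ([stop_prob_from_likely],
    [stop_prob_from_good_paths]).

    Good steps do not increase the density with respect to the uniform measure
    by more than a constant factor.  A step has about [N] equally likely
    outcomes, so what is needed is that a configuration [C] can be reached from
    only O(N) others.  Such a source is determined by the two half-edges of the
    bad edge that was removed.  These are at the same vertex ([D2] pairs), or
    their vertices are joined by an edge of [C] ([good_switch_source]).  The
    number of pairs of the latter kind is not O(n) for every [C], but it is in
    the mean ([mean_adjacent_pairs]), and one switching increases it by at most
    [4 * D2] ([adjacent_pairs_switch]), so that it stays O(n) during [K] steps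
    unless it was large at the start.  This gives, with a constant [L] that
    depends on eps but not on [n], P(process hits E) <= L * P(simple, projection in E) + eps
    ([run_prob_asymptotics]).

    Taken for all graphs at once, the same inequality shows that P(simple) is
    bounded away from 0 ([near_simple]), because a run ends in some graph with
    probability near 1.  This holds although the maximal degree can be of the
    order of the square root of [n].  Hence the two probabilities of [E] tend to
    0 together; complements give the limit 1. *)

(** * Configurations and their symmetries *)

Section Configurations.
Variables (n : nat) (d : 'I_n -> nat).
Local Notation H := (half_edge d).
Local Notation conf := (configurations d).
Implicit Types (C : {set {set H}}) (e f : {set H}) (x y a b k l : H).

Lemma configurationP C :
  reflect [/\ forall e, e \in C -> #|e| = 2,
              forall x, exists2 e, e \in C & x \in e
            & forall x e f, e \in C -> f \in C -> x \in e -> x \in f -> e = f]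
          (C \in conf).
Proof.
rewrite inE; apply: (iffP andP) => [[/and3P[/eqP cov /finset.trivIsetP triv _]
  /forall_inP two]|[two cov uniq]].
  split=> [e /two /eqP //|x|x e f eC fC xe xf].
    have: x \in finset.cover C by rewrite cov inE.
    by case/finset.bigcupP => e; exists e.
  apply/eqP/negPn/negP => /(triv _ _ eC fC) /pred0P /(_ x).
  by rewrite /= xe xf.
split; last by apply/forall_inP => e /two ->.
apply/and3P; split.
- apply/eqP/setP => x; rewrite inE; apply/finset.bigcupP.
  by have [e eC xe] := cov x; exists e.
- apply/finset.trivIsetP => e f eC fC; apply: contraR => /pred0Pn[x /andP[xe xf]].
  by rewrite (uniq x e f).
- by apply/negP => /two; rewrite cards0.
Qed.

Lemma edge_card C e : C \in conf -> e \in C -> #|e| = 2.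
Proof. by case/configurationP => two _ _ /two. Qed.

Lemma edge_eq C x e f : C \in conf ->
  e \in C -> f \in C -> x \in e -> x \in f -> e = f.
Proof. by case/configurationP => _ _; apply. Qed.

Lemma edge_neq C x y : C \in conf -> [set x; y] \in C -> x != y.
Proof. by move=> CP /(edge_card CP) /eqP; rewrite cards2; case: (x == y). Qed.

Lemma edgeP e : #|e| = 2 -> exists x y, x != y /\ e = [set x; y].
Proof. by move/eqP/cards2P => [x [y [nxy ->]]]; exists x, y. Qed.

Lemma partner_uniq C x y z : C \in conf ->
  [set x; y] \in C -> [set x; z] \in C -> y = z.
Proof.
move=> CP xyC xzC; have nxy := edge_neq CP xyC.
have := edge_eq CP xyC xzC (set21 _ _) (set21 _ _) => /setP /(_ y).
by rewrite !inE eqxx orbT [y == x]eq_sym (negPf nxy) => /esym/eqP.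
Qed.

Lemma edges_disjoint C a b k l : C \in conf ->
  [set a; b] \in C -> [set k; l] \in C -> [set k; l] != [set a; b] ->
  [/\ k != a, k != b, l != a & l != b].
Proof.
move=> CP abC klC ne; have E x := edge_eq (x := x) CP klC abC.
by split; apply: contraNneq ne => eqx; apply/eqP;
  [apply: (E k)|apply: (E k)|apply: (E l)|apply: (E l)]; rewrite eqx !inE eqxx ?orbT.
Qed.

Lemma card_half_edge_configuration C : C \in conf -> #|{: H}| = #|C|.*2.
Proof.
move=> CP; have := CP; rewrite inE => /andP[part _].
rewrite -muln2 -(finset.card_uniform_partition _ part) ?cardsT // => e.
exact: edge_card.
Qed.

Lemma card_half_edge : #|{: H}| = \sum_i d i.
Proof.
by rewrite card_tagged sumnE big_map big_enum; apply: eq_bigr => i _; rewrite card_ord.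
Qed.

Lemma sum_half_edge (F : 'I_n -> nat) : \sum_(x : H) F (tag x) = \sum_i d i * F i.
Proof.
rewrite -(sig_big_dep (fun=> true) (fun=> xpredT) (fun i _ => F i)) /=.
by apply: eq_bigr => i _; rewrite sum_nat_const card_ord.
Qed.

Lemma card_half_edges_at (i : 'I_n) : #|[set x : H | tag x == i]| = d i.
Proof.
rewrite -sum1_card (eq_bigl (fun x => tag x == i)) => [|x]; last by rewrite inE.
rewrite big_mkcond /= (sum_half_edge (fun j => (j == i : nat))).
by rewrite (bigD1 i) //= eqxx muln1 big1 ?addn0 // => j /negPf->; rewrite muln0.
Qed.

(** Permutations of the half-edges act on the configurations.  This gives the
    symmetries of the uniform measure; and a switching acts on [C] as a
    transposition, hence preserves configurations and can be undone. *)
Definition relabel (s : {perm H}) C : {set {set H}} :=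
  [set [set s x | x in e] | e : {set H} in C].

Lemma relabel_conf s C : (relabel s C \in conf) = (C \in conf).
Proof.
rewrite !inE -(imset_partition C _ (@perm_inj _ s)); congr (_ && _).
  congr (finset.partition _ _); apply/setP => x; rewrite inE; apply/esym/imsetP.
  by exists ((s^-1)%g x); rewrite ?inE ?permKV.
apply/forall_inP/forall_inP => two e.
  by move=> eC; rewrite -(card_imset _ (@perm_inj _ s)); apply/two/imset_f.
by case/imsetP => f /two fC ->; rewrite (card_imset _ (@perm_inj _ s)).
Qed.

Lemma mem_relabel (s : {perm H}) C e : ([set s x | x in e] \in relabel s C) = (e \in C).
Proof. by rewrite (mem_imset _ _ (imset_inj (@perm_inj _ s))). Qed.

Lemma relabel_inj s : injective (relabel s).
Proof. exact: imset_inj (imset_inj (@perm_inj _ s)). Qed.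

Lemma relabel_tpermK x y : involutive (relabel (tperm x y)).
Proof.
move=> C; rewrite /relabel -imset_comp -[RHS]imset_id; apply: eq_imset => e /=.
by rewrite -imset_comp -[RHS]imset_id; apply: eq_imset => z /=; rewrite tpermK.
Qed.

Lemma imset_pair (s : {perm H}) x y : [set s z | z in [set x; y]] = [set s x; s y].
Proof. by rewrite imsetU !imset_set1. Qed.

Lemma mem_relabel_pair (s : {perm H}) C x y :
  ([set s x; s y] \in relabel s C) = ([set x; y] \in C).
Proof. by rewrite -imset_pair mem_relabel. Qed.

Lemma tperm_fix x y z : z != x -> z != y -> tperm x y z = z.
Proof. by move=> zx zy; rewrite tpermD // eq_sym. Qed.

(** Exchanging [b] and [l] turns [ab], [kl] into [al], [kb] and moves no other
    edge. *)
Lemma switch_relabel C a b k l : C \in conf ->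
  [set a; b] \in C -> [set k; l] \in C -> [set k; l] != [set a; b] ->
  switch C (a, b) (k, l) = relabel (tperm b l) C.
Proof.
move=> CP abC klC ne; have [ka kb la lb] := edges_disjoint CP abC klC ne.
have ab := edge_neq CP abC; have kl := edge_neq CP klC.
have Eab : [set tperm b l z | z in [set a; b]] = [set a; l].
  by rewrite imset_pair tpermL tperm_fix // eq_sym.
have Ekl : [set tperm b l z | z in [set k; l]] = [set k; b].
  by rewrite imset_pair tpermR tperm_fix.
have Efix e : e \in C -> e != [set a; b] -> e != [set k; l] ->
    [set tperm b l z | z in e] = e.
  move=> eC eab ekl; rewrite -[RHS]imset_id; apply: eq_in_imset => z ze.
  apply: tperm_fix.
    apply: contraNneq eab => zb; apply/eqP/(edge_eq (x := z) CP) => //.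
    by rewrite zb !inE eqxx orbT.
  apply: contraNneq ekl => zl; apply/eqP/(edge_eq (x := z) CP) => //.
  by rewrite zl !inE eqxx orbT.
apply/setP => e; rewrite /switch /= !inE negb_or; apply/idP/imsetP.
- case/orP=> [/andP[/andP[e1 e2] eC]|/orP[]/eqP->].
  + by exists e => //; rewrite Efix.
  + by exists [set a; b].
  + by exists [set k; l].
- case=> f fC ->; have [->|f1] := eqVneq f [set a; b].
    by rewrite Eab eqxx orbT.
  have [->|f2] := eqVneq f [set k; l]; first by rewrite Ekl eqxx !orbT.
  by rewrite Efix // f1 f2 fC.
Qed.

Lemma switch_conf C a b k l : C \in conf ->
  [set a; b] \in C -> [set k; l] \in C -> [set k; l] != [set a; b] ->
  switch C (a, b) (k, l) \in conf.
Proof. by move=> *; rewrite switch_relabel // relabel_conf. Qed.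

Lemma switch_edges C a b k l :
  [set a; l] \in switch C (a, b) (k, l) /\ [set k; b] \in switch C (a, b) (k, l).
Proof. by rewrite !inE !eqxx !orbT. Qed.

(** ** Matching probabilities *)

(** By symmetry the half-edges in [Y] are the partner of [x] equally often, and
    [x] has only one partner; this replaces a count of perfect matchings. *)
Lemma exchangeable_partner (A : {set {set {set H}}}) (Y : {set H}) x y :
  A \subset conf -> x \notin Y -> y \in Y ->
  {in Y, forall z C, C \in A -> relabel (tperm y z) C \in A} ->
  #|[set C in A | [set x; y] \in C]| * #|Y| <= #|A|.
Proof.
move=> Aconf xY yY stable; set B := fun z => [set C in A | [set x; z] \in C].
have le_z z : z \in Y -> #|B y| <= #|B z|.
  move=> zY; rewrite -(card_imset _ (@relabel_inj (tperm y z))).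
  apply/subset_leq_card/fintype.subsetP => _ /imsetP[C + ->].
  rewrite !inE => /andP[CA xyC]; rewrite stable //=.
  rewrite -(mem_relabel_pair (tperm y z)) tpermL tperm_fix // in xyC.
  - by apply: contraNneq xY => ->.
  - by apply: contraNneq xY => ->.
rewrite mulnC -sum_nat_const.
apply: (@leq_trans (\sum_(z in Y) #|B z|)); first exact: leq_sum.
under eq_bigr => z _ do rewrite -sum1_card big_mkcond /=.
rewrite exchange_big -sum1_card [leqRHS]big_mkcond /=; apply: leq_sum => C _.
case: ifP => [CA|CA]; last by rewrite big1 // => z _; rewrite inE CA.
under eq_bigr => z _ do rewrite inE CA /=.
rewrite -big_mkcondr sum1_card; apply/card_le1P => z /andP[zY xzC] t.
apply/andP/eqP => [[_ xtC]|-> //].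
exact: partner_uniq (fintype.subsetP Aconf _ CA) xtC xzC.
Qed.

Lemma card_conf_edge x y :
  #|[set C in conf | [set x; y] \in C]| * #|{: H}|.-1 <= #|conf|.
Proof.
have [->|nxy] := eqVneq x y.
  rewrite (_ : [set C in conf | _] = finset.set0) ?cards0 //; apply/setP => C.
  rewrite [RHS]inE; apply/negbTE/negP => /setIdP[CP /(edge_neq CP)].
  by rewrite eqxx.
rewrite -(cardsC1 x); apply: exchangeable_partner => //.
- by rewrite !inE eqxx.
- by rewrite !inE eq_sym.
- by move=> z _ C CP; rewrite relabel_conf.
Qed.

(** Once [xy] is an edge, all half-edges other than [x], [y] and [a] are
    exchangeable as partners of [a]. *)
Lemma card_conf_edge2 x y a b : [set a; b] != [set x; y] ->
  #|[set C in conf | ([set x; y] \in C) && ([set a; b] \in C)]|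
    * (#|{: H}| - 3) * #|{: H}|.-1 <= #|conf|.
Proof.
move=> ne; set A := [set C in conf | [set x; y] \in C].
have eqA : [set C in conf | ([set x; y] \in C) && ([set a; b] \in C)]
         = [set C in A | [set a; b] \in C].
  by apply/setP => C; rewrite !inE andbA.
apply: leq_trans (card_conf_edge x y); rewrite leq_mul2r eqA; apply/orP; right.
have Aconf : A \subset conf by apply/fintype.subsetP => C /setIdP[].
have [->|[C0]] := finset.set_0Vmem [set C in A | [set a; b] \in C].
  by rewrite cards0.
move=> /setIdP[/setIdP[C0P xyC0] abC0].
have [ax ay bx b_y] := edges_disjoint C0P xyC0 abC0 ne.
have nxy := edge_neq C0P xyC0; have nab := edge_neq C0P abC0.
set Y := ~: [set x; y; a].
have cardY : #|Y| = #|{: H}| - 3.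
  by rewrite cardsCs finset.setCK;
     congr (_ - _); rewrite finset.setUC cardsU1 cards2 !inE nxy negb_or ax ay.
rewrite -cardY; apply: exchangeable_partner => //.
- by rewrite !inE eqxx orbT.
- by rewrite !inE !negb_or bx b_y eq_sym.
- move=> z; rewrite !inE !negb_or -andbA => /and3P[zx zy _] C.
  move=> /setIdP[CP xyC]; apply/setIdP; split; first by rewrite relabel_conf.
  rewrite -(mem_relabel_pair (tperm b z)) in xyC.
  by rewrite !tperm_fix // eq_sym in xyC.
Qed.

End Configurations.
(** * Bad edges and adjacent half-edges *)

Lemma set2_eq (T : finType) (a b c e : T) : [set a; b] = [set c; e] ->
  (a = c /\ b = e) \/ (a = e /\ b = c).
Proof.
move=> E; have ac := set21 a b; have be := set22 a b; have cc := set21 c e.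
have ee := set22 c e; rewrite E in ac be; rewrite -E in cc ee.
move: ac be cc ee; rewrite !inE.
by do 4![case/orP=> /eqP ?]; subst; auto.
Qed.

Lemma sum_sqr_split (I : finType) (F : I -> nat) :
  \sum_(p : I * I) F p.1 * F p.2 = (\sum_i F i) ^ 2.
Proof.
rewrite -(pair_bigA _ (fun i j => F i * F j)) /= -mulnn big_distrl /=.
by apply: eq_bigr => i _; rewrite big_distrr.
Qed.

Section Adjacency.
Variables (n : nat) (d : 'I_n -> nat).
Local Notation H := (half_edge d).
Local Notation conf := (configurations d).
Local Notation D2 := (\sum_i d i ^ 2).
Implicit Types (C : {set {set H}}) (e f : {set H}) (x y a b k l : H).

Definition bad_edges C : {set {set H}} := [set e | bad C e].

Definition adjacent C (i j : 'I_n) : bool := [exists f in C, ends f == [set i; j]].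

(** The size of this set controls how many configurations can be switched into
    [C]; compare [good_switch_source]. *)
Definition adjacent_pairs C : {set H * H} :=
  [set p | adjacent C (tag p.1) (tag p.2)].

Definition siblings : {set H * H} := [set p | tag p.1 == tag p.2].

Definition sibling_pairs : {set (H * H) * (H * H)} :=
  [set q | (tag q.1.1 == tag q.2.1) && (tag q.1.2 == tag q.2.2)].

Lemma ends_pair x y : ends [set x; y] = [set tag x; tag y].
Proof. by rewrite /ends imsetU !imset_set1. Qed.

Lemma ends_orient f (i j : 'I_n) : #|f| = 2 -> ends f = [set i; j] ->
  exists x y, [/\ f = [set x; y], tag x = i & tag y = j].
Proof.
move=> /edgeP[x [y [_ ->]]]; rewrite ends_pair => /set2_eq[] [xi yj].
  by exists x, y.
by exists y, x; rewrite finset.setUC.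
Qed.

Lemma loop_pair x y : loop [set x; y] = (tag x == tag y).
Proof. by rewrite /loop ends_pair cards2; case: (tag x == tag y). Qed.

Lemma degree_sum (i : 'I_n) : d i = \sum_(x : H) (i == tag x : nat).
Proof.
rewrite -card_half_edges_at -sum1_card [LHS]big_mkcond /=.
by apply: eq_bigr => x _; rewrite inE eq_sym; case: eqP.
Qed.

Lemma card_siblings : #|siblings| = D2.
Proof.
rewrite -sum1_card big_mkcond /=.
rewrite (eq_bigr (fun p => (tag p.1 == tag p.2 : nat))) => [|p _]; last first.
  by rewrite inE; case: eqP.
rewrite -(pair_bigA _ (fun x y => (tag x == tag y : nat))) /=.
transitivity (\sum_(x : H) d (tag x)); last by rewrite (sum_half_edge d).
by apply: eq_bigr => x _; rewrite degree_sum.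
Qed.

Lemma card_sibling_pairs : #|sibling_pairs| = D2 ^ 2.
Proof.
rewrite -sum1_card big_mkcond /=.
pose s (p q : H * H) := (tag p.1 == tag q.1 : nat) * (tag p.2 == tag q.2 : nat).
rewrite (eq_bigr (fun q => s q.1 q.2)) => [|q _]; last first.
  by rewrite inE /s; do 2!case: eqP.
rewrite -(pair_bigA _ s) /=.
transitivity (\sum_(p : H * H) d (tag p.1) * d (tag p.2)); last first.
  by rewrite (sum_sqr_split (fun x : H => d (tag x))) (sum_half_edge d).
apply: eq_bigr => p _.
rewrite -(pair_bigA _ (fun x y => (tag p.1 == tag x : nat) * (tag p.2 == tag y : nat))) /=.
rewrite [d _ in RHS]degree_sum big_distrl /=.
by apply: eq_bigr => x _; rewrite -big_distrr /= -degree_sum.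
Qed.

(** Linearity of expectation: [Q] lists the possible locations of a pattern, and
    each of them is occupied with probability at most [1 / w]. *)
Lemma mean_occurrences (T : finType) (Q : {set T}) (r : T -> {set {set H}} -> bool)
    (w : nat) :
  (forall q, q \in Q -> #|[set C in conf | r q C]| * w <= #|conf|) ->
  (\sum_(C in conf) #|[set q in Q | r q C]|) * w <= #|Q| * #|conf|.
Proof.
move=> le_q; rewrite -sum_nat_const.
apply: (@leq_trans (\sum_(q in Q) #|[set C in conf | r q C]| * w)).
  2: exact: leq_sum.
rewrite -big_distrl leq_mul2r /=; apply/orP; right.
rewrite (eq_bigr (fun C => \sum_(q in Q) (r q C : nat))) => [|C _]; last first.
  by rewrite -sum1_card -big_mkcondr; apply: eq_bigl => q; rewrite inE.
rewrite exchange_big /=; apply: leq_sum => q _.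
rewrite -big_mkcondr -sum1_card /=; apply: eq_leq; apply: eq_bigl => C.
by rewrite [RHS]finset.in_set.
Qed.

Lemma mean_adjacent_pairs :
  (\sum_(C in conf) #|adjacent_pairs C|) * #|{: H}|.-1 <= D2 ^ 2 * #|conf|.
Proof.
pose r (q : (H * H) * (H * H)) C := [set q.2.1; q.2.2] \in C.
have rare q : q \in sibling_pairs ->
    #|[set C in conf | r q C]| * #|{: H}|.-1 <= #|conf|.
  by move=> _; apply: card_conf_edge.
rewrite -card_sibling_pairs; apply: leq_trans (mean_occurrences rare).
rewrite leq_mul2r; apply/orP; right; apply: leq_sum => C CP.
apply: leq_trans (leq_imset_card fst _); apply/subset_leq_card/fintype.subsetP.
move=> p; rewrite inE => /exists_inP[f fC /eqP/(ends_orient (edge_card CP fC))].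
case=> x [y [def_f tx ty]]; apply/imsetP; exists (p, (x, y)) => //.
by rewrite !inE /r /= tx ty !eqxx -def_f.
Qed.

(** A bad edge that is not a loop has a parallel edge, and the two can be
    oriented so that their half-edges are siblings in order. *)
Lemma card_bad_edges C : C \in conf ->
  #|bad_edges C| <= #|[set p in siblings | [set p.1; p.2] \in C]|
    + #|[set q in sibling_pairs | [&& [set q.1.1; q.1.2] \in C,
           [set q.2.1; q.2.2] \in C & [set q.2.1; q.2.2] != [set q.1.1; q.1.2]]]|.
Proof.
move=> CP; set L := [set p in _ | _]; set M := [set q in _ | _].
apply: leq_trans (leq_add (leq_imset_card (fun p => [set p.1; p.2]) _)
                          (leq_imset_card (fun q => [set q.1.1; q.1.2]) _)).
apply: leq_trans (leq_card_setU _ _); apply/subset_leq_card/fintype.subsetP.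
move=> e; rewrite !inE => /andP[eC].
have [x [y [_ def_e]]] := edgeP (edge_card CP eC).
case/orP => [lp|/exists_inP[f fC /andP[ne /eqP ef]]].
  apply/orP; left; apply/imsetP; exists (x, y) => //.
  by rewrite !inE /= -loop_pair -def_e lp.
apply/orP; right; apply/imsetP; rewrite def_e ends_pair in ef.
have [u [v [def_f tu tv]]] := ends_orient (edge_card CP fC) ef.
by exists ((x, y), (u, v)); rewrite // !inE /= tu tv !eqxx -def_e -def_f eC fC ne.
Qed.

Lemma mean_bad_edges :
  (\sum_(C in conf) #|bad_edges C|) * ((#|{: H}| - 3) * #|{: H}|.-1)
  <= (D2 * (#|{: H}| - 3) + D2 ^ 2) * #|conf|.
Proof.
pose r1 (p : H * H) C := [set p.1; p.2] \in C.
pose r2 (q : (H * H) * (H * H)) C := [&& [set q.1.1; q.1.2] \in C,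
           [set q.2.1; q.2.2] \in C & [set q.2.1; q.2.2] != [set q.1.1; q.1.2]].
have le_sum : \sum_(C in conf) #|bad_edges C| <=
    \sum_(C in conf) #|[set p in siblings | r1 p C]|
    + \sum_(C in conf) #|[set q in sibling_pairs | r2 q C]|.
  by rewrite -big_split /=; apply: leq_sum => C /card_bad_edges.
apply: leq_trans (leq_mul le_sum (leqnn _)) _.
rewrite !mulnDl leq_add //.
  rewrite mulnA mulnAC [leqRHS]mulnAC leq_mul2r; apply/orP; right.
  rewrite -card_siblings; apply: (mean_occurrences (r := r1)) => p _.
  exact: card_conf_edge.
rewrite -card_sibling_pairs; apply: (mean_occurrences (r := r2)) => q _.
have [E|ne] := eqVneq [set q.2.1; q.2.2] [set q.1.1; q.1.2].
  rewrite (_ : [set C in conf | r2 q C] = finset.set0) ?cards0 //.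
  by apply/setP => C; rewrite [RHS]inE; apply/negbTE/negP => /setIdP[_];
     rewrite /r2 E eqxx !andbF.
rewrite mulnA; apply: leq_trans (card_conf_edge2 ne); rewrite !leq_mul2r.
do 2!(apply/orP; right); apply/subset_leq_card/fintype.subsetP => C /setIdP[CP].
by case/and3P => c1 c2 _; apply/setIdP; rewrite c1 c2.
Qed.

End Adjacency.
(** * Good switchings *)

Section Switching.
Variables (n : nat) (d : 'I_n -> nat).
Local Notation H := (half_edge d).
Local Notation conf := (configurations d).
Local Notation D2 := (\sum_i d i ^ 2).
Implicit Types (C : {set {set H}}) (e f : {set H}) (x y a b k l : H).

(** A good switching cannot turn an old edge into a bad one either: that edge
    would be parallel to a new edge, which would be bad too. *)
Definition good_switch C (ab kl : H * H) : bool :=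
  ~~ bad (switch C ab kl) [set ab.1; kl.2] && ~~ bad (switch C ab kl) [set kl.1; ab.2].

Definition switchable C (ab : H * H) : {set H * H} :=
  [set kl | [set kl.1; kl.2] \in C :\ [set ab.1; ab.2]].

Lemma switchableP C ab kl :
  reflect ([set kl.1; kl.2] \in C /\ [set kl.1; kl.2] != [set ab.1; ab.2])
          (kl \in switchable C ab).
Proof. by rewrite !inE andbC; apply: andP. Qed.

Lemma card_orientations e : #|e| = 2 -> #|[set kl : H * H | [set kl.1; kl.2] == e]| = 2.
Proof.
move=> /edgeP[x [y [nxy ->]]].
rewrite (_ : [set kl : H * H | _] = [set (x, y); (y, x)]).
  by rewrite cards2 xpair_eqE negb_and nxy.
apply/setP => -[k l]; rewrite !inE !xpair_eqE /=; apply/eqP/orP => [/set2_eq[][-> ->]|].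
- by left; rewrite !eqxx.
- by right; rewrite !eqxx.
- by case=> /andP[/eqP-> /eqP->] //; rewrite finset.setUC.
Qed.

Lemma sum_orientations (V : nmodType) (A : {set {set H}}) (F : H * H -> V) :
  (\sum_(e in A) \sum_(kl | [set kl.1; kl.2] == e) F kl
   = \sum_(kl | [set kl.1; kl.2] \in A) F kl)%R.
Proof.
rewrite (partition_big (fun kl : H * H => [set kl.1; kl.2]) (mem A)) //=.
apply: eq_bigr => e eA; apply: eq_bigl => kl.
by case: eqP => [->|]; rewrite ?eA ?andbF.
Qed.

Lemma card_orientations_in (A : {set {set H}}) : {in A, forall e, #|e| = 2} ->
  #|[set kl : H * H | [set kl.1; kl.2] \in A]| = #|A|.*2.
Proof.
move=> two; rewrite cardsE -sum1_card.
rewrite -(sum_orientations A (fun=> 1)) -muln2 -sum_nat_const.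
apply: eq_bigr => e /two/card_orientations <-; rewrite -sum1_card.
by apply: eq_bigl => kl; rewrite !inE.
Qed.

Lemma card_switchable C a b : C \in conf -> [set a; b] \in C ->
  #|switchable C (a, b)| = #|{: H}| - 2.
Proof.
move=> CP abC; rewrite card_orientations_in => [|e /setD1P[_]]; last exact: edge_card.
rewrite (card_half_edge_configuration CP) [#|C|](cardsD1 [set a; b]) abC.
by rewrite doubleD addKn.
Qed.

Lemma card_oriented_head C (S : {set H}) : C \in conf ->
  #|[set kl : H * H | ([set kl.1; kl.2] \in C) && (kl.2 \in S)]| <= #|S|.
Proof.
move=> CP; rewrite -(@card_in_imset _ _ snd) => [|[k l] [k' l']].
  by apply/subset_leq_card/fintype.subsetP => _ /imsetP[kl /[!inE]/andP[_ ?] ->].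
rewrite !inE /= => /andP[klC _] /andP[klC' _] el; rewrite -el in klC' *.
rewrite finset.setUC in klC; rewrite finset.setUC in klC'.
by rewrite (partner_uniq CP klC klC').
Qed.

Lemma card_oriented_tail C (S : {set H}) : C \in conf ->
  #|[set kl : H * H | ([set kl.1; kl.2] \in C) && (kl.1 \in S)]| <= #|S|.
Proof.
move=> CP; rewrite -(@card_in_imset _ _ fst) => [|[k l] [k' l']].
  by apply/subset_leq_card/fintype.subsetP => _ /imsetP[kl /[!inE]/andP[_ ?] ->].
rewrite !inE /= => /andP[klC _] /andP[klC' _] ek; rewrite -ek in klC' *.
by rewrite (partner_uniq CP klC klC').
Qed.

Lemma degree_sqr_le (i : 'I_n) : d i ^ 2 <= D2.
Proof. by rewrite (bigD1 i) //= leq_addr. Qed.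

Section OneSwitch.
Variables (C : {set {set H}}) (a b k l : H).
Hypotheses (CP : C \in conf) (abC : [set a; b] \in C) (klC : [set k; l] \in C).
Hypothesis ne : [set k; l] != [set a; b].
Local Notation C' := (switch C (a, b) (k, l)).

Lemma mem_switch e : e \in C' ->
  [\/ [/\ e \in C, e != [set a; b] & e != [set k; l]], e = [set a; l] | e = [set k; b]].
Proof.
rewrite !inE negb_or => /orP[/andP[/andP[e1 e2] eC]|/orP[]/eqP->].
- by constructor 1.
- by constructor 2.
- by constructor 3.
Qed.

Lemma mem_switch_old e : e \in C -> e != [set a; b] -> e != [set k; l] -> e \in C'.
Proof. by move=> eC e1 e2; rewrite !inE negb_or eC e1 e2. Qed.

Lemma new_edges_neq : [set a; l] != [set k; b].
Proof.
have [ka kb la lb] := edges_disjoint CP abC klC ne.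
apply/eqP => /set2_eq[] [E1 E2]; first by rewrite E1 eqxx in ka.
by move/negP: lb; rewrite E2; have := edge_neq CP klC; rewrite E2 eqxx.
Qed.

Lemma good_switch_bad_edges :
  good_switch C (a, b) (k, l) -> bad_edges C' \subset bad_edges C :\ [set a; b].
Proof.
case/andP=> /= good1 good2; apply/fintype.subsetP => e; rewrite !inE => eB.
have [e1 e2] : e != [set a; l] /\ e != [set k; b].
  by split; [apply: contraNneq good1 | apply: contraNneq good2] => <-.
have /andP[eC' _] := eB.
have [[eC -> _]|/eqP E|/eqP E] := mem_switch eC'; first last.
- by rewrite (negPf e2) in E.
- by rewrite (negPf e1) in E.
rewrite /bad eC /=; case/andP: eB => _ /orP[->//|/exists_inP[f fC' /andP[nfe ef]]].
apply/orP; right; apply/exists_inP; exists f; last by rewrite nfe ef.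
have [[]//|Ef|Ef] := mem_switch fC'.
- case/negP: good1; rewrite /bad -Ef fC' /=; apply/orP; right.
  apply/exists_inP; exists e; last by rewrite eq_sym nfe eq_sym ef.
  exact: eC'.
- case/negP: good2; rewrite /bad -Ef fC' /=; apply/orP; right.
  apply/exists_inP; exists e; last by rewrite eq_sym nfe eq_sym ef.
  exact: eC'.
Qed.

Lemma good_switch_fewer_bad : bad C [set a; b] ->
  good_switch C (a, b) (k, l) -> #|bad_edges C'| < #|bad_edges C|.
Proof.
move=> abB /good_switch_bad_edges /subset_leq_card /leq_ltn_trans; apply.
by rewrite [ltnRHS](cardsD1 [set a; b]) inE abB.
Qed.

(** This is what bounds the number of configurations that a good switching of
    a bad edge leads from: the edge [ab] that was removed was a loop, or else
    the edge to which it was parallel is still there. *)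
Lemma good_switch_source : bad C [set a; b] -> good_switch C (a, b) (k, l) ->
  (tag a == tag b) || adjacent C' (tag a) (tag b).
Proof.
case/andP=> _ /orP[lp|/exists_inP[f fC /andP[nf /eqP ef]]] /andP[/= good1 good2].
  by rewrite -loop_pair lp.
rewrite ends_pair in ef; have [alC' kbC'] := switch_edges C a b k l.
apply/orP; right; apply/exists_inP; exists f; last by rewrite ef.
apply: mem_switch_old => //; apply/eqP => fkl; move: ef; rewrite fkl ends_pair.
case/set2_eq => [] [tk tl].
- case/negP: good2; rewrite /bad kbC' /=; apply/orP; right; apply/exists_inP.
  exists [set a; l] => //; rewrite new_edges_neq !ends_pair tk tl.
  by rewrite eqxx.
- by case/negP: good1; rewrite /bad alC' loop_pair tl eqxx.
Qed.

Lemma card_pairs_over (i j : 'I_n) :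
  #|[set p : H * H | [set tag p.1; tag p.2] == [set i; j]]| <= 2 * D2.
Proof.
pose S (i : 'I_n) := [set x : H | tag x == i].
apply: (@leq_trans #|finset.setX (S i) (S j) :|: finset.setX (S j) (S i)|).
  apply/subset_leq_card/fintype.subsetP => -[x y]; rewrite !inE /=.
  by case/eqP/set2_eq => [] [-> ->]; rewrite !eqxx ?orbT.
apply: leq_trans (leq_card_setU _ _) _.
rewrite !cardsX /S !card_half_edges_at [d j * _]mulnC addnn -mul2n.
have [le_ij _] := nat_Cauchy (d i) (d j).
by apply: leq_trans le_ij _; rewrite mul2n -addnn leq_add // degree_sqr_le.
Qed.

(** An edge between [i] and [j] accounts for at most [2 * d i * d j <= 2 * D2]
    adjacent pairs: a bound linear in the number of vertices, even for degrees
    of the order of its square root. *)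
Lemma adjacent_pairs_switch : #|adjacent_pairs C'| <= #|adjacent_pairs C| + 4 * D2.
Proof.
pose X i j := [set p : H * H | [set tag p.1; tag p.2] == [set i; j]].
apply: (@leq_trans #|adjacent_pairs C :|: (X (tag a) (tag l) :|: X (tag k) (tag b))|).
  apply/subset_leq_card/fintype.subsetP => p; rewrite !inE.
  case/exists_inP => f /mem_switch[[fC _ _]|->|->]; rewrite ?ends_pair => ep.
  - by apply/orP; left; apply/exists_inP; exists f.
  - by rewrite eq_sym ep orbT.
  - by rewrite [X in _ || (_ || X)]eq_sym ep !orbT.
apply: leq_trans (leq_card_setU _ _) _; rewrite leq_add2l.
apply: leq_trans (leq_card_setU _ _) _.
by rewrite (mulnDl 2 2) leq_add // card_pairs_over.
Qed.

End OneSwitch.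

(** ** Most switchings are good *)

Section MostGood.
Variables (C : {set {set H}}).
Hypothesis CP : C \in conf.

Definition half_edges_next (i : 'I_n) : {set H} := [set x | adjacent C i (tag x)].

Lemma card_neighbours (i : 'I_n) : #|[set j | adjacent C i j]| <= d i.
Proof.
rewrite -(card_half_edges_at d i).
apply: leq_trans (card_oriented_head [set x | tag x == i] CP).
apply: leq_trans (leq_imset_card (fun kl => tag kl.1) _).
apply/subset_leq_card/fintype.subsetP => j; rewrite inE => /exists_inP[f fC /eqP ef].
have [x [y [def_f tx ty]]] := ends_orient (edge_card CP fC) ef.
apply/imsetP; exists (y, x) => //; rewrite !inE /= tx eqxx andbT.
by rewrite finset.setUC -def_f.
Qed.

(** A half-edge next to [i] is at one of at most [d i] vertices [j], and
    [r * d j <= r ^ 2 + d j ^ 2].  As [d i ^ 2 <= D2], the number of these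
    half-edges is small compared to [D2] when [D2] and [r] are large. *)
Lemma card_half_edges_next (i : 'I_n) (r : nat) :
  r * #|half_edges_next i| <= r ^ 2 * d i + D2.
Proof.
have -> : #|half_edges_next i| = \sum_(j | adjacent C i j) d j.
  rewrite -sum1_card big_mkcond [RHS]big_mkcond /=.
  rewrite (eq_bigr (fun x => adjacent C i (tag x) : nat)) => [|x _]; last first.
    by rewrite inE; case: ifP.
  rewrite (sum_half_edge d (fun j => adjacent C i j : nat)).
  by apply: eq_bigr => j _; case: ifP; rewrite ?muln1 ?muln0.
apply: (@leq_trans (\sum_(j | adjacent C i j) (r ^ 2 + d j ^ 2))).
  rewrite big_distrr /=; apply: leq_sum => j _; have [+ _] := nat_Cauchy r (d j).
  by apply: leq_trans; rewrite leq_pmull.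
rewrite big_split /= leq_add //.
  rewrite sum_nat_const mulnC leq_mul2l; apply/orP; right.
  by have := card_neighbours i; rewrite cardsE.
by rewrite [leqRHS](bigID (adjacent C i)) leq_addr.
Qed.

(** The new edge [al] is bad if [l] is at the vertex of [a] or at a neighbour of
    it, and similarly for [kb].  If [al] and [kb] are parallel to one another,
    then either [ab] already makes [l] a neighbour of [a], or [kl] was a loop. *)
Lemma bad_switch_cases a b kl : [set a; b] \in C ->
  kl \in switchable C (a, b) -> ~~ good_switch C (a, b) kl ->
  [\/ (tag kl.2 = tag a) \/ (tag kl.1 = tag b), kl.2 \in half_edges_next (tag a),
      kl.1 \in half_edges_next (tag b) | bad C [set kl.1; kl.2]].
Proof.
case: kl => k l abC /switchableP[/= klC ne].
have [alC' kbC'] := switch_edges C a b k l.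
have new_ne := new_edges_neq CP abC klC ne.
have parallel : [set tag a; tag l] = [set tag k; tag b] ->
    l \in half_edges_next (tag a) \/ loop [set k; l].
  move=> /set2_eq[] [tak tlb]; last by right; rewrite loop_pair tlb.
  left; rewrite inE; apply/exists_inP; exists [set a; b] => //.
  by rewrite ends_pair tlb.
rewrite negb_and !negbK => /orP[] /andP[_ /orP[]]; rewrite /= ?loop_pair.
- by move/eqP; constructor 1; left.
- case/exists_inP => f /mem_switch[[fC _ _]|->|->] /andP[nf]; rewrite ?ends_pair => /eqP ef.
  + constructor 2; rewrite inE; apply/exists_inP; exists f; rewrite ?ef //.
  + by rewrite eqxx in nf.
  + have [lT|lp] := parallel (esym ef); first by constructor 2.
    by constructor 4; rewrite /bad klC lp.
- by move/eqP; constructor 1; right.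
- case/exists_inP => f /mem_switch[[fC _ _]|->|->] /andP[nf]; rewrite ?ends_pair => /eqP ef.
  + constructor 3; rewrite inE; apply/exists_inP; exists f => //.
    by rewrite ef finset.setUC.
  + have [lT|lp] := parallel ef; first by constructor 2.
    by constructor 4; rewrite /bad klC lp.
  + by rewrite eqxx in nf.
Qed.

(** Only [D2 / r] matters for large graphs: when [D2 = O(N)] and the number of
    bad edges is bounded, a large constant [r] makes the fraction of switchings
    that are not good as small as desired. *)
Lemma few_bad_switchings a b (r : nat) : [set a; b] \in C -> 0 < r ->
  r * #|[set kl in switchable C (a, b) | ~~ good_switch C (a, b) kl]|
  <= 2 * r ^ 5 + 4 * D2 + 2 * r * #|bad_edges C|.
Proof.
move=> abC r_gt0.
pose S (i : 'I_n) := [set x : H | tag x == i].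
pose O2 (X : {set H}) := [set kl : H * H | ([set kl.1; kl.2] \in C) && (kl.2 \in X)].
pose O1 (X : {set H}) := [set kl : H * H | ([set kl.1; kl.2] \in C) && (kl.1 \in X)].
pose B := [set kl : H * H | [set kl.1; kl.2] \in bad_edges C].
set X := [set kl in _ | _].
have subX : X \subset O2 (S (tag a)) :|: O1 (S (tag b))
    :|: O2 (half_edges_next (tag a)) :|: O1 (half_edges_next (tag b)) :|: B.
  apply/fintype.subsetP => kl; rewrite inE => /andP[klS ngood].
  have [klC _] := switchableP _ _ _ klS.
  have [[E|E]|E|E|E] := bad_switch_cases abC klS ngood.
  - by rewrite !inE klC E eqxx ?orbT.
  - by rewrite !inE klC E eqxx ?orbT.
  - by rewrite !finset.in_setU [_ \in O2 (half_edges_next _)]inE klC E ?orbT.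
  - by rewrite !finset.in_setU [_ \in O1 (half_edges_next _)]inE klC E ?orbT.
  - by rewrite !finset.in_setU [_ \in B]inE [_ \in bad_edges _]inE E ?orbT.
have cardB : #|B| = 2 * #|bad_edges C|.
  rewrite card_orientations_in ?mul2n // => e; rewrite inE => /andP[eC _].
  exact: edge_card eC.
have cardX : #|X| <= d (tag a) + d (tag b) + #|half_edges_next (tag a)|
    + #|half_edges_next (tag b)| + 2 * #|bad_edges C|.
  apply: leq_trans (subset_leq_card subX) _.
  apply: leq_trans (leq_card_setU _ _) (leq_add _ _); last by rewrite cardB.
  apply: leq_trans (leq_card_setU _ _) (leq_add _ _); last exact: card_oriented_tail.
  apply: leq_trans (leq_card_setU _ _) (leq_add _ _); last exact: card_oriented_head.
  apply: leq_trans (leq_card_setU _ _) (leq_add _ _).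
    by rewrite -(card_half_edges_at d (tag a)); apply: card_oriented_head.
  by rewrite -(card_half_edges_at d (tag b)); apply: card_oriented_tail.
have da := degree_sqr_le (tag a); have db := degree_sqr_le (tag b).
have ha := card_half_edges_next (tag a) r.
have hb := card_half_edges_next (tag b) r.
move: cardX da db ha hb; move: #|X| (d (tag a)) (d (tag b)) #|half_edges_next _|.
move: #|half_edges_next _| #|bad_edges C| D2 => h2 B0 D x da db h1.
move=> le_x le_a le_b le_h1 le_h2.
(* The degree terms are linear in [t] while only [t ^ 2] is bounded by [D]. *)
have small t : t ^ 2 <= D -> r * t + r ^ 2 * t <= r ^ 5 + D.
  move=> le_t; have [le1 _] := nat_Cauchy r t; have [le2 _] := nat_Cauchy (r ^ 2) t.
  have le25 : r ^ 2 <= r ^ 5 by rewrite leq_pexp2l.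
  have le45 : r ^ 4 <= r ^ 5 by rewrite leq_pexp2l.
  by rewrite -expnM in le2; lia.
have := small _ le_a; have := small _ le_b.
by have := leq_mul (leqnn r) le_x; rewrite !mulnDr; lia.
Qed.

End MostGood.
End Switching.
(** * Simple configurations over a given graph *)

Section Fibers.
Variables (n : nat) (d : 'I_n -> nat).
Local Notation H := (half_edge d).
Local Notation conf := (configurations d).
Implicit Types (C : {set {set H}}) (e f : {set H}) (x y : H) (G : graph n).

Definition fiber G : {set {set {set H}}} :=
  [set C in conf | ~~ has_bad C && (projection C == G)].

Definition incident G (i : 'I_n) : graph n := [set g in G | i \in g].

(** A simple configuration over [G] amounts to a choice, at every vertex, of the
    edge of [G] to which each half-edge belongs. *)
Definition labelings G : {set {ffun H -> {set 'I_n}}} :=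
  [set phi : {ffun H -> {set 'I_n}} | [forall x, phi x \in incident G (tag x)]
    && injectiveb (fun x => (tag x, phi x))].

Definition edge_label C : {ffun H -> {set 'I_n}} :=
  [ffun x => ends (finset.pblock C x)].

Lemma labelingP G (phi : {ffun H -> {set 'I_n}}) :
  reflect ((forall x, phi x \in incident G (tag x)) /\
           forall x y, tag x = tag y -> phi x = phi y -> x = y)
          (phi \in labelings G).
Proof.
rewrite inE; apply: (iffP andP) => -[inc inj]; split.
- exact/forallP.
- by move=> x y txy pxy; apply: (injectiveP _ inj); rewrite /= txy pxy.
- exact/forallP.
- by apply/injectiveP => x y [txy pxy]; apply: inj.
Qed.

Lemma incident_card G (i : 'I_n) : G \in graphs_with_degrees d -> #|incident G i| = d i.
Proof. by rewrite inE => /andP[_ /forallP/(_ i)/eqP]. Qed.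

Section OneConfiguration.
Variable C : {set {set H}}.
Hypotheses (CP : C \in conf) (Csimple : ~~ has_bad C).

Lemma conf_trivIset : finset.trivIset C.
Proof. by move: CP; rewrite inE => /andP[/and3P[]]. Qed.

Lemma conf_partition : finset.partition C [set: H].
Proof. by move: CP; rewrite inE => /andP[]. Qed.

Lemma pblock_conf x : finset.pblock C x \in C /\ x \in finset.pblock C x.
Proof.
have cov : x \in finset.cover C by rewrite (finset.cover_partition conf_partition) inE.
by rewrite finset.pblock_mem // finset.mem_pblock.
Qed.

Lemma simple_ends_inj e f : e \in C -> f \in C -> ends e = ends f -> e = f.
Proof.
move=> eC fC ef; apply: contraNeq Csimple => ne; apply/existsP; exists e.
rewrite /bad eC /=; apply/orP; right; apply/exists_inP; exists f => //.
by rewrite eq_sym ne ef eqxx.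
Qed.

Lemma simple_loop e : e \in C -> ~~ loop e.
Proof.
move=> eC; apply: contra Csimple => le; apply/existsP; exists e.
by rewrite /bad eC le.
Qed.

Lemma simple_card_ends e : e \in C -> #|ends e| = 2.
Proof.
move=> eC; have := simple_loop eC; have [x [y [_ ->]]] := edgeP (edge_card CP eC).
by rewrite /loop ends_pair cards2; case: (tag x == tag y).
Qed.

Lemma edge_label_pblock x y :
  (edge_label C x == edge_label C y) = (finset.pblock C x == finset.pblock C y).
Proof.
rewrite !ffunE; apply/eqP/eqP => [|-> //].
by apply: simple_ends_inj; apply: (pblock_conf _).1.
Qed.

Lemma edge_label_labeling : edge_label C \in labelings (projection C).
Proof.
apply/labelingP; split=> [x|x y txy /eqP].
  have [eC xe] := pblock_conf x; rewrite ffunE inE imset_f //=.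
  exact: imset_f.
rewrite edge_label_pblock => /eqP pxy; have [eC xe] := pblock_conf x.
have ye := (pblock_conf y).2; rewrite -pxy in ye.
apply: contraNeq (simple_loop eC) => nxy.
have [u [v [_ def_e]]] := edgeP (edge_card CP eC).
rewrite def_e !inE in xe ye; rewrite def_e loop_pair.
move: nxy txy; case/orP: xe => /eqP->; case/orP: ye => /eqP->; rewrite ?eqxx //.
  by move=> _ ->.
by move=> _ ->.
Qed.

Lemma preim_partition_edge_label : finset.preim_partition (edge_label C) [set: H] = C.
Proof.
rewrite -[RHS](finset.preim_partition_pblock conf_partition).
apply: eq_imset => x; apply/setP => y; rewrite !inE /=.
exact: edge_label_pblock.
Qed.

Lemma projection_degrees : projection C \in graphs_with_degrees d.
Proof.
rewrite inE; apply/andP; split.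
  by apply/forall_inP => _ /imsetP[e eC ->]; rewrite simple_card_ends.
have [inc inj] := labelingP _ _ edge_label_labeling.
apply/forallP => i; apply/eqP; rewrite -(card_half_edges_at d i).
rewrite -(@card_in_imset _ _ (edge_label C) [set x : H | tag x == i]); last first.
  by move=> x y; rewrite !inE => /eqP tx /eqP ty; apply: inj; rewrite tx ty.
apply: eq_card => g; apply/idP/imsetP.
  rewrite inE => /andP[/imsetP[e eC ->] /imsetP[x xe ->]]; exists x; rewrite ?inE //.
  have [fC xf] := pblock_conf x.
  by rewrite ffunE (edge_eq CP eC fC xe xf).
by case=> x; rewrite inE => /eqP <- ->; apply: inc.
Qed.

End OneConfiguration.

Section OneLabeling.
Variables (G : graph n) (phi : {ffun H -> {set 'I_n}}).
Hypotheses (GP : G \in graphs_with_degrees d) (phiP : phi \in labelings G).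
Local Notation C := (finset.preim_partition phi [set: H]).

(** An injection between sets of the same size [d i] is onto. *)
Lemma labeling_onto (i : 'I_n) g : g \in incident G i -> exists x, tag x = i /\ phi x = g.
Proof.
have [inc inj] := labelingP _ _ phiP.
have sub : [set phi x | x in [set x : H | tag x == i]] \subset incident G i.
  by apply/fintype.subsetP => _ /imsetP[x /[!inE]/eqP<- ->]; have := inc x; rewrite inE.
have /eqP <- : [set phi x | x in [set x : H | tag x == i]] == incident G i.
  rewrite eqEcard sub (incident_card _ GP) card_in_imset ?card_half_edges_at ?leqnn //.
  by move=> x y; rewrite !inE => /eqP tx /eqP ty; apply: inj; rewrite tx ty.
by case/imsetP => x; rewrite inE => /eqP tx ->; exists x.
Qed.

Lemma graph_edge_card g : g \in G -> #|g| = 2.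
Proof. by move: GP; rewrite inE => /andP[/forall_inP two _] /two/eqP. Qed.

Definition label_block x : {set H} := [set y | phi y == phi x].

Lemma preim_partitionE : C = [set label_block x | x in [set: H]].
Proof.
by apply: eq_imset => x; apply/setP => y; rewrite !inE /= eq_sym.
Qed.

Lemma ends_label_block x : ends (label_block x) = phi x.
Proof.
have [inc _] := labelingP _ _ phiP.
apply/setP => i; apply/imsetP/idP => [[y /[!inE]/eqP <- ->]|ix].
  by have := inc y; rewrite inE => /andP[].
have : phi x \in incident G i by have := inc x; rewrite !inE ix andbT => /andP[].
by case/labeling_onto => y [<- yx]; exists y; rewrite // inE yx.
Qed.

Lemma card_label_block x : #|label_block x| = 2.
Proof.
have [inc inj] := labelingP _ _ phiP.
have <- : #|phi x| = 2 by apply: graph_edge_card; have := inc x; rewrite inE => /andP[].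
rewrite -ends_label_block card_in_imset // => y z.
by rewrite !inE => /eqP py /eqP pz tyz; apply: inj; rewrite // py pz.
Qed.

Lemma labeling_conf : C \in conf.
Proof.
rewrite inE finset.preim_partitionP preim_partitionE /=.
by apply/forall_inP => _ /imsetP[x _ ->]; rewrite card_label_block.
Qed.

Lemma labeling_simple : ~~ has_bad C.
Proof.
apply/existsPn => e; rewrite /bad preim_partitionE.
apply/negP => /andP[/imsetP[x _ ->]].
have [inc _] := labelingP _ _ phiP.
rewrite /loop ends_label_block graph_edge_card /=; last first.
  by have := inc x; rewrite inE => /andP[].
case/exists_inP => _ /imsetP[y _ ->]; rewrite !ends_label_block => /andP[/eqP ne /eqP E].
by case: ne; rewrite /label_block E.
Qed.

Lemma labeling_projection : projection C = G.
Proof.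
have [inc _] := labelingP _ _ phiP.
apply/setP => g; rewrite /projection preim_partitionE; apply/imsetP/idP.
  case=> _ /imsetP[x _ ->] ->; rewrite ends_label_block.
  by have := inc x; rewrite inE => /andP[].
move=> gG; have /card_gt0P[i ig] : (0 < #|g|)%N by rewrite graph_edge_card.
have [|x [_ <-]] := @labeling_onto i g; first by rewrite inE gG.
by exists (label_block x); rewrite ?ends_label_block ?imset_f.
Qed.

Lemma edge_label_preim_partition : edge_label C = phi.
Proof.
apply/ffunP => x; rewrite ffunE -[RHS]ends_label_block; congr ends.
apply: finset.def_pblock; rewrite ?inE //.
  exact: (conf_trivIset labeling_conf).
by rewrite preim_partitionE imset_f.
Qed.

End OneLabeling.

(** The blocks of the partition induced by a labeling are the edges of the
    configuration; the degree condition makes each of them meet both ends. *)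
Lemma card_fiber_labelings G : G \in graphs_with_degrees d ->
  #|fiber G| = #|labelings G|.
Proof.
move=> GP; apply/eqP; rewrite eqn_leq; apply/andP; split.
  rewrite -(@card_in_imset _ _ edge_label (fiber G)); last first.
    move=> C C' /setIdP[CP /andP[Cs _]] /setIdP[C'P /andP[C's _]] E.
    by rewrite -(preim_partition_edge_label CP Cs) E preim_partition_edge_label.
  apply/subset_leq_card/fintype.subsetP => _ /imsetP[C /setIdP[CP /andP[Cs /eqP <-]] ->].
  exact: edge_label_labeling.
pose P (phi : {ffun H -> {set 'I_n}}) := finset.preim_partition phi [set: H].
rewrite -(@card_in_imset _ _ P (labelings G)).
  apply/subset_leq_card/fintype.subsetP => _ /imsetP[phi phiP ->]; apply/setIdP; split.
    exact: labeling_conf GP phiP.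
  by rewrite (labeling_simple GP phiP) (labeling_projection GP phiP) eqxx.
move=> phi psi phiP psiP E.
by rewrite -(edge_label_preim_partition GP phiP) -/(P phi) E (edge_label_preim_partition GP psiP).
Qed.

(** At each vertex both graphs have the same number of incident edges, so that
    the edges of [G] in a labeling can be replaced by those of [G'] of the same
    rank. *)
Lemma leq_card_labelings G G' :
  G \in graphs_with_degrees d -> G' \in graphs_with_degrees d ->
  (#|labelings G| <= #|labelings G'|)%N.
Proof.
move=> GP G'P.
pose tr (i : 'I_n) g := nth finset.set0 (enum (incident G' i)) (index g (enum (incident G i))).
have lt_index i g : g \in incident G i ->
    (index g (enum (incident G i)) < size (enum (incident G' i)))%N.
  move=> gi; rewrite -cardE incident_card // -(incident_card i GP) cardE index_mem.
  by rewrite mem_enum.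
have tr_inj i : {in incident G i &, injective (tr i)}.
  move=> g h gi hi /eqP; rewrite nth_uniq ?enum_uniq ?lt_index // => /eqP E.
  rewrite -(mem_enum (incident G i)) in gi; rewrite -(mem_enum (incident G i)) in hi.
  by rewrite -(nth_index finset.set0 gi) E nth_index.
pose T (phi : {ffun H -> {set 'I_n}}) : {ffun H -> {set 'I_n}} :=
  [ffun x => tr (tag x) (phi x)].
rewrite -(@card_in_imset _ _ T (labelings G)).
  apply/subset_leq_card/fintype.subsetP => _ /imsetP[phi /labelingP[inc inj] ->].
  apply/labelingP; split=> [x|x y txy].
    by rewrite ffunE -mem_enum mem_nth // lt_index.
  rewrite !ffunE txy => /tr_inj E; apply: inj => //; apply: E => //.
  by rewrite -txy.
move=> phi psi /labelingP[inc _] /labelingP[inc' _] /ffunP E; apply/ffunP => x.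
by have := E x; rewrite !ffunE => /tr_inj; apply.
Qed.

Lemma labelings_gt0 G : G \in graphs_with_degrees d -> (0 < #|labelings G|)%N.
Proof.
move=> GP; apply/card_gt0P.
pose rank (x : {i : 'I_n & 'I_(d i)}) : nat := tagged x.
exists [ffun x : H => nth finset.set0 (enum (incident G (tag x))) (rank x)].
have lt (x : H) : (rank x < size (enum (incident G (tag x))))%N.
  by rewrite -cardE incident_card //; apply: ltn_ord.
apply/labelingP; split=> [x|[i u] [j v] /= ij].
  by rewrite ffunE -mem_enum mem_nth.
case: j / ij v => v; rewrite !ffunE => /eqP.
rewrite nth_uniq ?enum_uniq ?(lt (Tagged _ u)) ?(lt (Tagged _ v)) //=.
by move=> /eqP/ord_inj /= ->.
Qed.

Lemma configurations_gt0 : graphic d -> (0 < #|conf|)%N.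
Proof.
case=> G GP; have := labelings_gt0 GP; rewrite -card_fiber_labelings //.
by move=> /card_gt0P[C /setIdP[CP _]]; apply/card_gt0P; exists C.
Qed.

Lemma card_simple_over (E : {set graph n}) :
  #|[set C in conf | ~~ has_bad C && (projection C \in E)]|
  = \sum_(G in E :&: graphs_with_degrees d) #|fiber G|.
Proof.
rewrite -sum1_card (partition_big (@projection n d) (mem (E :&: graphs_with_degrees d))) /=.
  apply: eq_bigr => G /finset.setIP[GE _]; rewrite -sum1_card; apply: eq_bigl => C.
  apply/andP/setIdP => [[/setIdP[CP /andP[Cs _]] CG]|[CP /andP[Cs CG]]].
    by rewrite CP Cs.
  by split; rewrite ?CG //; apply/setIdP; rewrite CP Cs (eqP CG).
move=> C /setIdP[CP /andP[Cs CE]]; rewrite finset.in_setI CE /=.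
exact: projection_degrees.
Qed.

(** All graphs with the given degrees being the projections of equally many
    simple configurations, a uniform simple configuration projects onto a
    uniform graph. *)
Lemma simple_projection_uniform (E : {set graph n}) :
  (#|[set C in conf | ~~ has_bad C && (projection C \in E)]| * #|graphs_with_degrees d|
   = #|[set C in conf | ~~ has_bad C && (projection C \in [set: graph n])]|
     * #|E :&: graphs_with_degrees d|)%N.
Proof.
have [->|[G0 G0P]] := finset.set_0Vmem (graphs_with_degrees d).
  by rewrite finset.setI0 cards0 !muln0.
have count (A : {set graph n}) :
    #|[set C in conf | ~~ has_bad C && (projection C \in A)]|
    = (#|A :&: graphs_with_degrees d| * #|fiber G0|)%N.
  rewrite card_simple_over -sum_nat_const; apply: eq_bigr => G /finset.setIP[_ GP].
  rewrite !card_fiber_labelings //; apply/eqP.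
  by rewrite eqn_leq !leq_card_labelings.
by rewrite !count finset.setTI; nia.
Qed.

End Fibers.
(** * The switching process *)

Local Open Scope ring_scope.

Section Process.
Variables (R : realType) (n : nat) (d : 'I_n -> nat).
Local Notation H := (half_edge d).
Local Notation conf := (configurations d).
Local Notation D2 := (\sum_i d i ^ 2)%N.
Implicit Types (C : {set {set H}}) (E : {set graph n}) (ab kl : H * H).

(** ** One step of the process *)

Section Rule.
Variable rho : selection_rule R d.
Hypothesis valid : valid_rule rho.
Local Notation S := (stop_prob_from rho).

(** The two orientations of an edge, each of probability 1/2, are merged with
    the uniform choice among the [N / 2 - 1] other edges into a uniform choice
    among [N - 2] oriented edges. *)
Lemma stop_prob_fromS t past C E : C \in conf -> has_bad C ->
  S t.+1 past C E = \sum_ab rho past C ab *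
    ((#|{: H}| - 2)%:R^-1 *
      \sum_(kl in switchable C ab) S t (rcons past C) (switch C ab kl) E).
Proof.
move=> CP Cbad; rewrite /= Cbad /=; apply: eq_bigr => ab _; congr (_ * _).
under eq_bigr => f _ do rewrite -mulr_sumr mulrA.
rewrite -mulr_sumr sum_orientations; congr (_ * _).
  rewrite -invfM -natrM muln2 (card_half_edge_configuration CP).
  by rewrite -subn1 doubleB.
by apply: eq_bigl => kl; rewrite !inE.
Qed.

Lemma stop_prob_from_stopped t past C E : ~~ has_bad C ->
  S t past C E = (projection C \in E)%:R.
Proof. by case: t => [|t] /= ->. Qed.

Lemma stop_prob_from0 past C E : has_bad C -> S 0 past C E = 0.
Proof. by move=> /= ->. Qed.

Lemma rule_average_le past C (g : H * H -> R) (m : R) : C \in conf -> has_bad C ->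
  (forall ab, bad C [set ab.1; ab.2] -> g ab <= m) ->
  \sum_ab rho past C ab * g ab <= m.
Proof.
move=> CP Cbad le_m; have [ge0 supp sum1] := valid past CP Cbad.
rewrite -[m]mul1r -sum1 mulr_suml; apply: ler_sum => ab _.
have [->|/supp abB] := eqVneq (rho past C ab) 0; first by rewrite !mul0r.
by rewrite ler_wpM2l ?ge0 ?le_m.
Qed.

Lemma rule_average_ge past C (g : H * H -> R) (m : R) : C \in conf -> has_bad C ->
  (forall ab, bad C [set ab.1; ab.2] -> m <= g ab) ->
  m <= \sum_ab rho past C ab * g ab.
Proof.
move=> CP Cbad le_m; rewrite -lerN2 -sumrN.
under eq_bigr => ab _ do rewrite -mulrN.
by apply: rule_average_le => // ab /le_m; rewrite lerN2.
Qed.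

Lemma switchable_conf C ab kl : C \in conf -> bad C [set ab.1; ab.2] ->
  kl \in switchable C ab -> switch C ab kl \in conf.
Proof.
case: ab kl => a b [k l] CP /andP[abC _] /switchableP[klC ne].
exact: switch_conf.
Qed.

Lemma card_switchable_bad C ab : C \in conf -> bad C [set ab.1; ab.2] ->
  #|switchable C ab| = (#|{: H}| - 2)%N.
Proof. by case: ab => a b CP /andP[abC _]; rewrite card_switchable. Qed.

Lemma stop_prob_from_ge0 t past C E : C \in conf -> 0 <= S t past C E.
Proof.
elim: t past C => [|t IH] past C CP.
  by rewrite /=; case: ifP => // _; rewrite ler0n.
have [Cbad|Cgood] := boolP (has_bad C); last by rewrite stop_prob_from_stopped ?ler0n.
rewrite stop_prob_fromS //; apply: rule_average_ge => // ab abB.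
rewrite mulr_ge0 ?invr_ge0 ?ler0n //; apply: sumr_ge0 => kl klS.
by apply: IH; apply: switchable_conf.
Qed.

Lemma stop_prob_from_le1 t past C E : C \in conf -> S t past C E <= 1.
Proof.
elim: t past C => [|t IH] past C CP.
  by rewrite /=; case: ifP => // _; rewrite lern1 leq_b1.
have [Cbad|Cgood] := boolP (has_bad C); last first.
  by rewrite stop_prob_from_stopped // lern1 leq_b1.
rewrite stop_prob_fromS //; apply: rule_average_le => // ab abB.
apply: (@le_trans _ _ ((#|{: H}| - 2)%:R^-1 * (#|{: H}| - 2)%:R)); last first.
  have [->|nz] := eqVneq ((#|{: H}| - 2)%:R : R) 0; first by rewrite mulr0.
  by rewrite mulVf.
rewrite ler_wpM2l ?invr_ge0 ?ler0n // -(card_switchable_bad CP abB) -sumr_const.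
by apply: ler_sum => kl klS; apply: IH; apply: switchable_conf.
Qed.

Lemma stop_prob_fromC t past C E : C \in conf ->
  S t past C E + S t past C (~: E) = S t past C [set: graph n].
Proof.
elim: t past C => [|t IH] past C CP.
all: have [Cbad|Cgood] := boolP (has_bad C); last first.
1,3: by rewrite !stop_prob_from_stopped // !inE; case: (_ \in E); rewrite ?addr0 ?add0r.
  by rewrite !stop_prob_from0 ?addr0.
rewrite !stop_prob_fromS // -big_split /=; apply: eq_bigr => ab _.
have [->|nz] := eqVneq (rho past C ab) 0; first by rewrite !mul0r addr0.
have [_ supp _] := valid past CP Cbad.
rewrite -mulrDr -mulrDr -big_split /=; congr (_ * (_ * _)).
apply: eq_bigr => kl klS; apply: IH; apply: switchable_conf => //.
exact: supp.
Qed.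

Lemma stop_prob_from_mono t past C E : C \in conf ->
  S t past C E <= S t.+1 past C E.
Proof.
elim: t past C => [|t IH] past C CP.
all: have [Cbad|Cgood] := boolP (has_bad C); last by rewrite !stop_prob_from_stopped.
  by rewrite stop_prob_from0 // stop_prob_from_ge0.
rewrite !(stop_prob_fromS _ _ _ CP Cbad); apply: ler_sum => ab _.
have [ge0 supp _] := valid past CP Cbad.
have [->|nz] := eqVneq (rho past C ab) 0; first by rewrite !mul0r.
rewrite ler_wpM2l // ler_wpM2l ?invr_ge0 ?ler0n //.
by apply: ler_sum => kl klS; apply: IH; apply: switchable_conf; rewrite ?supp.
Qed.

End Rule.

(** ** Reversing the process *)

Definition stopped_in E C : R := (~~ has_bad C && (projection C \in E))%:R.

Definition good_step_sum (h : {set {set H}} -> R) C : R :=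
  (#|{: H}| - 2)%:R^-1 *
    \sum_(ab : H * H | bad C [set ab.1; ab.2])
      \sum_(kl in switchable C ab | good_switch C ab kl) h (switch C ab kl).

(** This bounds the probability that good switchings alone lead from [C] to a
    simple configuration in [E] within [t] steps.  Replacing the probability that
    the rule selects a bad edge by 1 removes the dependence on the rule and on
    the past. *)
Fixpoint good_paths (t : nat) E C : R :=
  stopped_in E C + if t is t'.+1 then good_step_sum (good_paths t' E) C else 0.

Lemma good_step_sum_ge0 (h : {set {set H}} -> R) C :
  (forall C, 0 <= h C) -> 0 <= good_step_sum h C.
Proof.
move=> h_ge0; rewrite mulr_ge0 ?invr_ge0 ?ler0n //.
by apply: sumr_ge0 => ab _; apply: sumr_ge0.
Qed.

Lemma good_paths_ge0 t E C : 0 <= good_paths t E C.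
Proof.
elim: t C => [|t IH] C; rewrite /= addr_ge0 ?ler0n //.
exact: good_step_sum_ge0.
Qed.

Lemma stopped_in_le_good_paths t E C : stopped_in E C <= good_paths t E C.
Proof.
case: t => [|t]; rewrite /= lerDl // good_step_sum_ge0 // => ?.
exact: good_paths_ge0.
Qed.

(** The pairs [ab], [kl] whose good switching, [ab] being bad, can have led
    to [C]. *)
Definition good_sources C : {set (H * H) * (H * H)} :=
  [set q | [&& [set q.1.1; q.2.2] \in C, [set q.2.1; q.1.2] \in C
     & (tag q.1.1 == tag q.1.2) || adjacent C (tag q.1.1) (tag q.1.2)]].

(** The half-edges of [kl] are the partners in [C] of those of [ab]. *)
Lemma card_good_sources C : C \in conf ->
  (#|good_sources C| <= D2 + #|adjacent_pairs C|)%N.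
Proof.
move=> CP; rewrite -card_siblings -(@card_in_imset _ _ fst); last first.
  move=> [[a b] [k l]] [[a' b'] [k' l']]; rewrite !inE /=.
  move=> /and3P[alC kbC _] /and3P[alC' kbC' _] [ea eb].
  rewrite -ea in alC'; rewrite -eb in kbC'.
  rewrite finset.setUC in kbC; rewrite finset.setUC in kbC'.
  by rewrite ea eb (partner_uniq CP alC alC') (partner_uniq CP kbC kbC').
apply: leq_trans (leq_card_setU _ _); apply/subset_leq_card/fintype.subsetP.
by move=> _ /imsetP[q + ->]; rewrite !inE => /and3P[_ _].
Qed.

(** For given half-edges [ab], [kl] switching is a bijection, so the double sum
    can be rearranged according to the resulting configuration; each of these
    then occurs once for each of its good sources. *)
Lemma sum_good_step (h : {set {set H}} -> R) (z : nat) : (forall C, 0 <= h C) ->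
  \sum_(C in conf | (#|adjacent_pairs C| <= z)%N) good_step_sum h C
  <= (D2 + (z + 4 * D2))%:R / (#|{: H}| - 2)%:R *
     \sum_(C in conf | (#|adjacent_pairs C| <= z + 4 * D2)%N) h C.
Proof.
move=> h_ge0; rewrite /good_step_sum -mulr_sumr mulrAC mulrC ler_wpM2r ?invr_ge0 ?ler0n //.
under [leLHS]eq_bigr => C _ do rewrite pair_big_dep /=.
rewrite (exchange_big_dep xpredT) //= mulr_sumr.
apply: (@le_trans _ _ (\sum_(C in conf | (#|adjacent_pairs C| <= z + 4 * D2)%N)
                        \sum_(q in good_sources C) h C)); last first.
  apply: ler_sum => C /andP[CP Cz]; rewrite sumr_const -[leLHS]mulr_natl.
  rewrite ler_wpM2r // ler_nat; apply: leq_trans (card_good_sources CP) _.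
  by rewrite leq_add2l.
rewrite [leRHS](exchange_big_dep xpredT) //=; apply: ler_sum => -[[a b] [k l]] _ /=.
rewrite (reindex_inj (@relabel_inj _ _ (tperm b l))) /=.
rewrite big_mkcond [leRHS]big_mkcond /=; apply: ler_sum => C' _.
set C := relabel (tperm b l) C'; case: ifP => [|_]; last by case: ifP.
rewrite relabel_conf => /andP[/andP[C'P Cz] /and3P[abB klS good]].
have CP : C \in conf by rewrite relabel_conf.
have [/= klC ne] := switchableP _ _ _ klS; have /andP[abC _] := abB.
have EC' : switch C (a, b) (k, l) = C'.
  by rewrite switch_relabel // relabel_tpermK.
have := good_switch_source CP abC klC ne abB good.
have := adjacent_pairs_switch C a b k l; have [] := switch_edges C a b k l.
rewrite EC' => alC' kbC' adj src; rewrite C'P inE /= alC' kbC' src /=.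
by rewrite (leq_trans adj) ?leq_add2r.
Qed.

(** [beta] bounds the factor by which one good step changes the total weight;
    [Z] leaves room for the adjacent pairs that [t] steps can add. *)
Lemma sum_good_paths (t z Z : nat) E (beta : R) : (z + t * (4 * D2) <= Z)%N ->
  beta = (D2 + Z)%:R / (#|{: H}| - 2)%:R ->
  \sum_(C in conf | (#|adjacent_pairs C| <= z)%N) good_paths t E C
  <= (1 + beta) ^+ t * \sum_(C in conf) stopped_in E C.
Proof.
move=> + def_beta; have beta_ge0 : 0 <= beta by rewrite def_beta divr_ge0 ?ler0n.
set X := \sum_(C in conf) _; have X_ge0 : 0 <= X by apply: sumr_ge0.
have le_X y : \sum_(C in conf | (#|adjacent_pairs C| <= y)%N) stopped_in E C <= X.
  rewrite big_mkcondr; apply: ler_sum => C _.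
  by case: ifP => // _; rewrite ler0n.
elim: t z => [|t IH] z le_Z.
  by rewrite expr0 mul1r; under eq_bigr => C _ do rewrite /= addr0.
rewrite /= big_split /=.
have := sum_good_step z (@good_paths_ge0 t E).
have le_Z' : (z + 4 * D2 + t * (4 * D2) <= Z)%N by rewrite -addnA -mulSn.
move: (IH _ le_Z') => {}IH step.
have le_beta : (D2 + (z + 4 * D2))%:R / (#|{: H}| - 2)%:R <= beta.
  rewrite def_beta ler_wpM2r ?invr_ge0 ?ler0n // ler_nat leq_add2l.
  by apply: leq_trans le_Z'; rewrite leq_addr.
rewrite exprS mulrDl mul1r mulrDl lerD //.
  apply: le_trans (le_X z) _; rewrite ler_peMl // exprn_ege1 // lerDl //.
apply: le_trans step _; rewrite -[leRHS]mulrA; apply: ler_pM => //.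
  by rewrite divr_ge0 ?ler0n.
by apply: sumr_ge0 => C _; apply: good_paths_ge0.
Qed.

(** ** Almost all runs follow good steps *)

Section Run.
Variables (rho : selection_rule R d) (K : nat) (eta : R).
Hypothesis valid : valid_rule rho.
Hypothesis N_gt2 : (2 < #|{: H}|)%N.
Hypothesis eta_ge0 : 0 <= eta.
Hypothesis few_not_good : forall C a b, C \in conf -> [set a; b] \in C ->
  (#|bad_edges C| <= K)%N ->
  #|[set kl in switchable C (a, b) | ~~ good_switch C (a, b) kl]|%:R
  <= eta * (#|{: H}| - 2)%:R.
Local Notation S := (stop_prob_from rho).
Local Notation M := ((#|{: H}| - 2)%:R : R).

Lemma switchable_count_gt0 : 0 < M.
Proof. by rewrite ltr0n subn_gt0. Qed.

Lemma card_not_good C ab : C \in conf -> bad C [set ab.1; ab.2] ->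
  (#|bad_edges C| <= K)%N ->
  \sum_(kl in switchable C ab | ~~ good_switch C ab kl) 1 <= eta * M.
Proof.
case: ab => a b CP /andP[abC _] CK; apply: le_trans (few_not_good CP abC CK).
rewrite sumr_const ler_nat; apply/subset_leq_card/fintype.subsetP => kl.
by rewrite inE.
Qed.

Lemma sum_switchable C ab (F : H * H -> R) :
  \sum_(kl in switchable C ab) F kl =
  \sum_(kl in switchable C ab | good_switch C ab kl) F kl +
  \sum_(kl in switchable C ab | ~~ good_switch C ab kl) F kl.
Proof. by rewrite (bigID (good_switch C ab)). Qed.

Lemma good_step_fewer_bad C ab kl : C \in conf -> bad C [set ab.1; ab.2] ->
  kl \in switchable C ab -> good_switch C ab kl ->
  (#|bad_edges (switch C ab kl)| < #|bad_edges C|)%N.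
Proof.
case: ab kl => a b [k l] CP abB /switchableP[klC ne] good.
by apply: good_switch_fewer_bad; case/andP: (abB).
Qed.

Lemma no_bad_edges C : (#|bad_edges C| <= 0)%N -> ~~ has_bad C.
Proof.
rewrite leqn0 cards_eq0 => /eqP/setP E; apply/existsPn => e.
by have := E e; rewrite !inE => ->.
Qed.

(** Each good step removes a bad edge, so [t] good steps in a row are enough;
    each of them fails with probability at most [eta], whatever the past. *)
Lemma stop_prob_from_likely t past C : C \in conf ->
  (#|bad_edges C| <= t)%N -> (t <= K)%N ->
  1 - t%:R * eta <= S t past C [set: graph n].
Proof.
elim: t past C => [|t IH] past C CP Ct tK.
  by rewrite mul0r subr0 stop_prob_from_stopped ?no_bad_edges // inE.
have teta_ge0 : 0 <= t.+1%:R * eta by rewrite mulr_ge0 ?ler0n.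
have [Cbad|Cgood] := boolP (has_bad C); last first.
  by rewrite stop_prob_from_stopped // inE gerBl.
have [le_teta|lt_teta] := leP (t%:R * eta) 1; last first.
  apply: le_trans (stop_prob_from_ge0 valid _ _ _ CP).
  rewrite subr_le0 (le_trans (ltW lt_teta)) // ler_wpM2r //.
  by rewrite ler_nat.
rewrite stop_prob_fromS //; apply: rule_average_ge => // ab abB.
have CK := leq_trans Ct tK.
rewrite ler_pdivlMl ?switchable_count_gt0 // sum_switchable.
apply: (@le_trans _ _ (\sum_(kl in switchable C ab | good_switch C ab kl)
                         (1 - t%:R * eta))); last first.
  rewrite -[leLHS]addr0 lerD //.
    apply: ler_sum => kl /andP[klS good]; apply: IH.
    - exact: switchable_conf klS.
    - by rewrite -ltnS (leq_trans (good_step_fewer_bad CP abB klS good)).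
    - exact: ltnW.
  apply: sumr_ge0 => kl /andP[klS _].
  exact/(stop_prob_from_ge0 valid)/(switchable_conf CP abB).
have : \sum_(kl in switchable C ab) (1 : R) = M.
  by rewrite sumr_const (card_switchable_bad CP abB).
rewrite sum_switchable; have := card_not_good CP abB CK.
set g := \sum_(kl in _ | good_switch _ _ _) 1.
set w := \sum_(kl in _ | ~~ _) 1 => le_w def_M.
have -> : \sum_(kl in switchable C ab | good_switch C ab kl) (1 - t%:R * eta)
        = g * (1 - t%:R * eta).
  by rewrite /g mulr_suml; under [RHS]eq_bigr => kl _ do rewrite mul1r.
apply: (@le_trans _ _ ((M - eta * M) * (1 - t%:R * eta))); last first.
  by rewrite ler_wpM2r ?subr_ge0 // lerBlDr -[leLHS]def_M lerD2l.
have : 0 <= M * (eta * (t%:R * eta)) by rewrite !mulr_ge0 ?ler0n.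
by rewrite -natr1; lra.
Qed.

(** A run either takes good steps only or, with probability at most [t * eta],
    takes at some time a step that is not good. *)
Lemma stop_prob_from_good_paths t past C E : C \in conf ->
  (#|bad_edges C| <= K)%N ->
  S t past C E <= good_paths t E C + t%:R * eta.
Proof.
elim: t past C => [|t IH] past C CP CK.
all: have [Cbad|Cgood] := boolP (has_bad C); last by
  rewrite stop_prob_from_stopped // -[leLHS]addr0 lerD ?mulr_ge0 ?ler0n //;
  apply: le_trans (stopped_in_le_good_paths _ _ _); rewrite /stopped_in Cgood.
  by rewrite stop_prob_from0 // addr_ge0 ?good_paths_ge0 // mulr_ge0.
rewrite stop_prob_fromS //; apply: rule_average_le => // ab abB.
set G := \sum_(kl in switchable C ab | good_switch C ab kl)
           good_paths t E (switch C ab kl).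
have le_G : M^-1 * G <= good_paths t.+1 E C.
  rewrite /= -[leLHS]add0r lerD ?ler0n // /good_step_sum.
  rewrite ler_wpM2l ?invr_ge0 ?ler0n // (bigD1 ab) //= lerDl.
  by apply: sumr_ge0 => ? _; apply: sumr_ge0 => ? _; apply: good_paths_ge0.
suff le_sum : \sum_(kl in switchable C ab) S t (rcons past C) (switch C ab kl) E
    <= G + M * (t.+1%:R * eta).
  apply: le_trans (lerD le_G (lexx _)); rewrite ler_pdivrMl ?switchable_count_gt0 // mulrDr.
  by rewrite mulVKf ?gt_eqF ?switchable_count_gt0.
have : \sum_(kl in switchable C ab) (1 : R) = M.
  by rewrite sumr_const (card_switchable_bad CP abB).
rewrite !sum_switchable; have := card_not_good CP abB CK.
set g := \sum_(kl in _ | good_switch _ _ _) 1.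
set w := \sum_(kl in _ | ~~ _) 1 => le_w def_M.
apply: (@le_trans _ _ ((G + g * (t%:R * eta)) + w)).
  apply: lerD; last first.
    apply: ler_sum => kl /andP[klS _].
    exact/(stop_prob_from_le1 valid)/(switchable_conf CP abB).
  rewrite /g mulr_suml -big_split /=; apply: ler_sum => kl /andP[klS good].
  rewrite mul1r; apply: IH; first exact: switchable_conf klS.
  exact/ltnW/(leq_trans (good_step_fewer_bad CP abB klS good)).
have w_ge0 : 0 <= w by apply: sumr_ge0.
have : 0 <= w * (t%:R * eta) by rewrite !mulr_ge0 ?ler0n.
by rewrite -def_M -natr1 in le_w *; lra.
Qed.

End Run.
End Process.
(** * Runs of the process and their restarts *)

Section Runs.
Variables (R : realType) (n : nat) (d : 'I_n -> nat) (rho : selection_rule R d).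
Hypotheses (graphic_d : graphic d) (valid : valid_rule rho).
Local Notation H := (half_edge d).
Local Notation conf := (configurations d).
Local Notation D2 := (\sum_i d i ^ 2)%N.
Local Notation S := (stop_prob_from rho).
Local Notation allG := ([set: graph n]).
Implicit Types (C : {set {set H}}) (E : {set graph n}).

Lemma card_conf_gt0 : 0 < #|conf|%:R :> R.
Proof. by rewrite ltr0n configurations_gt0. Qed.

Lemma mean_one : #|conf|%:R^-1 * (\sum_(C in conf) 1) = 1 :> R.
Proof. by rewrite sumr_const mulVf // gt_eqF ?card_conf_gt0. Qed.

Lemma stop_prob_ge0 t E : 0 <= stop_prob rho t E.
Proof.
rewrite mulr_ge0 ?invr_ge0 ?ler0n // sumr_ge0 // => C.
exact: stop_prob_from_ge0.
Qed.

Lemma stop_prob_le1 t E : stop_prob rho t E <= 1.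
Proof.
rewrite -[leRHS]mean_one ler_wpM2l ?invr_ge0 ?ler0n // ler_sum // => C.
exact: stop_prob_from_le1.
Qed.

Lemma stop_probC t E : stop_prob rho t E + stop_prob rho t (~: E) = stop_prob rho t allG.
Proof.
rewrite -mulrDr -big_split /=; congr (_ * _); apply: eq_bigr => C.
exact: stop_prob_fromC.
Qed.

Lemma stop_prob_mono E : {homo stop_prob rho ^~ E : t u / (t <= u)%N >-> t <= u}.
Proof.
apply: homo_leq => [//|x y z|t]; first exact: le_trans.
rewrite ler_wpM2l ?invr_ge0 ?ler0n // ler_sum // => C.
exact: stop_prob_from_mono.
Qed.

Lemma is_cvg_stop_prob E : cvgn (stop_prob rho ^~ E).
Proof.
apply: nondecreasing_is_cvgn; first exact: stop_prob_mono.
by exists 1 => _ [t _ <-]; apply: stop_prob_le1.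
Qed.

Lemma stop_prob_le_run t E : stop_prob rho t E <= run_prob rho E.
Proof.
exact: nondecreasing_cvgn_le (@stop_prob_mono E) (@is_cvg_stop_prob E) t.
Qed.

Lemma run_prob_ge0 E : 0 <= run_prob rho E.
Proof. exact: le_trans (stop_prob_ge0 0 E) (stop_prob_le_run 0 E). Qed.

Lemma run_prob_le1 E : run_prob rho E <= 1.
Proof.
apply: limr_le; first exact: is_cvg_stop_prob.
by apply: nearW => t; apply: stop_prob_le1.
Qed.

Lemma run_probC E : run_prob rho E + run_prob rho (~: E) = run_prob rho allG.
Proof.
apply/esym/cvg_lim; first exact: Rhausdorff.
have -> : stop_prob rho ^~ allG = fun t => stop_prob rho t E + stop_prob rho t (~: E).
  by apply/funext => t; rewrite stop_probC.
by apply: cvgD; apply: is_cvg_stop_prob.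
Qed.

(** A run that ends in [E] does so within [t] steps, unless it takes more. *)
Lemma run_prob_le t E :
  run_prob rho E <= stop_prob rho t E + (1 - stop_prob rho t allG).
Proof.
have := stop_prob_le_run t (~: E); have := stop_probC t E; have := run_probC E.
by have := run_prob_le1 allG; lra.
Qed.

(** The number of failed runs is geometric. *)
Lemma switched_probE E : 0 < run_prob rho allG ->
  switched_prob rho E = run_prob rho E / run_prob rho allG.
Proof.
move=> run_gt0; set p := run_prob rho allG in run_gt0 *; set q := run_prob rho E.
have -> : switched_prob rho E = limn (series (geometric q (1 - p))).
  rewrite /switched_prob -/p -/q; congr (limn (series _)).
  by apply/funext => r; rewrite /= mulrC.
have p_le1 : p <= 1 by apply: run_prob_le1.
have lt1 : `|1 - p| < 1 by rewrite ger0_norm ?subr_ge0 // gtrBl.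
have := @cvg_geometric_series R q (1 - p) lt1; rewrite opprB addrCA subrr addr0.
by move/cvg_lim; apply; apply: Rhausdorff.
Qed.

Lemma switched_probC E : 0 < run_prob rho allG ->
  switched_prob rho (~: E) = 1 - switched_prob rho E.
Proof.
move=> run_gt0; rewrite !switched_probE //.
have -> : run_prob rho (~: E) = run_prob rho allG - run_prob rho E.
  by rewrite -(run_probC E) addrAC subrr add0r.
by rewrite mulrBl divff ?lt0r_neq0.
Qed.

Lemma card_graphs_gt0 : 0 < #|graphs_with_degrees d|%:R :> R.
Proof. by have [G GP] := graphic_d; rewrite ltr0n; apply/card_gt0P; exists G. Qed.

Lemma uniform_prob_ge0 E : 0 <= uniform_prob R d E.
Proof. by rewrite divr_ge0 ?ler0n. Qed.

Lemma uniform_probC E : uniform_prob R d (~: E) = 1 - uniform_prob R d E.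
Proof.
have nz := lt0r_neq0 card_graphs_gt0.
rewrite /uniform_prob -[X in X - _](divff nz) -mulrBl; congr (_ / _).
rewrite -[in RHS](cardsID E) natrD -[E :&: _]finset.setIC addrAC subrr add0r.
by rewrite finset.setDE finset.setIC.
Qed.

(** Within 0 steps a run ends only if its initial configuration is simple. *)
Lemma stop_prob0E E :
  stop_prob rho 0 E = #|conf|%:R^-1 * \sum_(C in conf) stopped_in R E C.
Proof.
congr (_ * _); apply: eq_bigr => C _; rewrite /= /stopped_in.
by case: (~~ has_bad C).
Qed.

Lemma stop_prob0_uniform E :
  stop_prob rho 0 E = stop_prob rho 0 allG * uniform_prob R d E.
Proof.
have card_stopped A : \sum_(C in conf) stopped_in R A C =
    #|[set C in conf | ~~ has_bad C && (projection C \in A)]|%:R.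
  rewrite -natr_sum; congr (_%:R); rewrite -big_mkcondr -sum1_card.
  by apply: eq_bigl => C; rewrite [RHS]finset.in_set.
rewrite !stop_prob0E !card_stopped /uniform_prob -!mulrA; congr (_ * _).
rewrite [RHS]mulrA; apply: (canRL (mulfK (lt0r_neq0 card_graphs_gt0))).
by rewrite -!natrM; congr (_%:R); apply: simple_projection_uniform.
Qed.

(** ** Bounds for finitely many vertices *)

Section Bounds.
Variables (K z : nat) (eta : R).
Hypotheses (N_gt2 : (2 < #|{: H}|)%N) (eta_ge0 : 0 <= eta).
Hypothesis few_not_good : forall C a b, C \in conf -> [set a; b] \in C ->
  (#|bad_edges C| <= K)%N ->
  #|[set kl in switchable C (a, b) | ~~ good_switch C (a, b) kl]|%:R
  <= eta * (#|{: H}| - 2)%:R.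

Definition many_bad_prob : R :=
  #|conf|%:R^-1 * \sum_(C in conf) (K < #|bad_edges C|)%N%:R.

Definition many_adjacent_prob : R :=
  #|conf|%:R^-1 * \sum_(C in conf) (z < #|adjacent_pairs C|)%N%:R.

Lemma mean_cst (a : R) : #|conf|%:R^-1 * (\sum_(C in conf) a) = a.
Proof. by rewrite sumr_const -[a *+ _]mulr_natl mulKf // gt_eqF ?card_conf_gt0. Qed.

Lemma stop_prob_likely : 1 - K%:R * eta - many_bad_prob <= stop_prob rho K allG.
Proof.
rewrite -[1 - _]mean_cst -mulrBr -sumrB ler_wpM2l ?invr_ge0 ?ler0n //.
apply: ler_sum => C CP; case: ltnP => CK /=; last first.
  by rewrite subr0; apply: stop_prob_from_likely few_not_good _ _ _ _ _ _.
apply: le_trans (stop_prob_from_ge0 valid _ _ _ CP).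
by have : 0 <= K%:R * eta; [rewrite mulr_ge0 ?ler0n|lra].
Qed.

Lemma stop_prob_dominated (beta : R) E :
  beta = (D2 + (z + K * (4 * D2)))%:R / (#|{: H}| - 2)%:R ->
  stop_prob rho K E <= (1 + beta) ^+ K * stop_prob rho 0 E
    + K%:R * eta + many_bad_prob + many_adjacent_prob.
Proof.
move=> def_beta; rewrite stop_prob0E.
have le_sum : \sum_(C in conf) S K [::] C E <=
    (1 + beta) ^+ K * (\sum_(C in conf) stopped_in R E C)
    + \sum_(C in conf) K%:R * eta
    + \sum_(C in conf) (K < #|bad_edges C|)%N%:R
    + \sum_(C in conf) (z < #|adjacent_pairs C|)%N%:R.
  apply: le_trans (lerD (lerD (lerD (sum_good_paths E (leqnn _) def_beta)
    (lexx _)) (lexx _)) (lexx _)).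
  rewrite big_mkcondr -!big_split /=; apply: ler_sum => C CP.
  have Keta_ge0 : 0 <= K%:R * eta by rewrite mulr_ge0 ?ler0n.
  have gp_ge0 := @good_paths_ge0 R n d K E C.
  have S_le1 := stop_prob_from_le1 valid K [::] E CP.
  have [CK|CK] := leqP #|bad_edges C| K; last first.
    by case: ifP => _; case: (ltnP z) => _ /=; lra.
  have := stop_prob_from_good_paths valid N_gt2 eta_ge0 few_not_good K [::] E CP CK.
  by case: (leqP #|adjacent_pairs C| z) => _ /=; lra.
apply: le_trans (ler_wpM2l _ le_sum) _; first by rewrite invr_ge0 ler0n.
by rewrite !mulrDr mean_cst mulrCA.
Qed.

Lemma markov_inequality (F : {set {set H}} -> nat) (k : nat) :
  k.+1%:R * (#|conf|%:R^-1 * \sum_(C in conf) (k < F C)%N%:R)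
  <= #|conf|%:R^-1 * (\sum_(C in conf) F C)%:R :> R.
Proof.
rewrite mulrCA ler_wpM2l ?invr_ge0 ?ler0n // natr_sum mulr_sumr.
by apply: ler_sum => C _; case: ltnP => /= lt_k; rewrite ?mulr1 ?mulr0 ?ler_nat ?ler0n.
Qed.

End Bounds.

(** Allows replacing the denominators [N - 1], [N - 2] and [N - 3] by [N / 2]. *)
Lemma half_edges_half (k : nat) : (k <= 3)%N -> (6 <= #|{: H}|)%N ->
  #|{: H}|%:R <= 2 * (#|{: H}| - k)%:R :> R.
Proof. by move=> k3 N6; rewrite -natrM ler_nat; lia. Qed.

Lemma many_bad_prob_le (K : nat) (q : R) : (6 <= #|{: H}|)%N -> 0 <= q ->
  D2%:R <= q * #|{: H}|%:R -> K.+1%:R * many_bad_prob K <= 2 * q + 4 * q ^+ 2.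
Proof.
move=> N6 q_ge0 le_D2; apply: le_trans (markov_inequality _ K) _.
have N1 := half_edges_half (isT : 1 <= 3)%N N6; rewrite subn1 in N1.
have N3 := half_edges_half (isT : 3 <= 3)%N N6.
have : (#|{: H}| - 3)%:R > 0 :> R by rewrite ltr0n subn_gt0; lia.
have : #|{: H}|.-1%:R > 0 :> R by rewrite ltr0n; lia.
have := mean_bad_edges d; rewrite -(ler_nat R) !natrM natrD !natrM.
have := card_conf_gt0; move: N1 N3 le_D2.
set A := (\sum_(C in conf) _)%:R; set c := #|conf|%:R; set D := D2%:R.
set N := #|_|%:R; set N1 := _.-1%:R; set N3 := (_ - _)%:R.
move=> le_N1 le_N3 le_D c_gt0 le_A N1_gt0 N3_gt0.
have D_ge0 : 0 <= D by rewrite ler0n.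
rewrite ler_pdivrMl // -(ler_pM2r (mulr_gt0 N3_gt0 N1_gt0)).
apply: le_trans le_A _; rewrite [c * _]mulrC [leRHS]mulrAC ler_wpM2r ?(ltW c_gt0) //.
have D1 : D <= 2 * q * N1 by rewrite -mulrA mulrCA (le_trans le_D) // ler_wpM2l.
have D3 : D <= 2 * q * N3 by rewrite -mulrA mulrCA (le_trans le_D) // ler_wpM2l.
have := ler_pM D_ge0 D_ge0 D1 D3; have := ler_wpM2r (ltW N3_gt0) D1.
by rewrite !expr2; lra.
Qed.

Lemma many_adjacent_prob_le (z : nat) (q : R) : (6 <= #|{: H}|)%N -> 0 <= q ->
  D2%:R <= q * #|{: H}|%:R -> z.+1%:R * many_adjacent_prob z <= 2 * q * D2%:R.
Proof.
move=> N6 q_ge0 le_D2; apply: le_trans (markov_inequality _ z) _.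
have N1 := half_edges_half (isT : 1 <= 3)%N N6; rewrite subn1 in N1.
have : #|{: H}|.-1%:R > 0 :> R by rewrite ltr0n; lia.
have := mean_adjacent_pairs d; rewrite -(ler_nat R) !natrM.
have := card_conf_gt0; move: N1 le_D2.
set A := (\sum_(C in conf) _)%:R; set c := #|conf|%:R; set D := D2%:R.
set N := #|_|%:R; set N1 := _.-1%:R.
move=> le_N1 le_D c_gt0 le_A N1_gt0; have D_ge0 : 0 <= D by rewrite ler0n.
rewrite ler_pdivrMl // -(ler_pM2r N1_gt0).
apply: le_trans le_A _; rewrite [c * _]mulrC [leRHS]mulrAC ler_wpM2r ?(ltW c_gt0) //.
rewrite mulrAC ler_wpM2r // -mulrA mulrCA (le_trans le_D) //.
by rewrite ler_wpM2l.
Qed.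

End Runs.
(** * Asymptotics *)

Local Open Scope classical_set_scope.

Section Asymptotics.
Variable R : realType.

(** Five events or errors of probability at most [e = eps / 5] are involved:
    more than [K] bad edges or a step that is not good (each counted once for the
    upper bound and once for the lower bound), and more than [m * n] adjacent
    pairs at the start. *)
Lemma run_prob_asymptotics (c0 C2 eps : R) : 0 < c0 -> 0 < C2 -> 0 < eps ->
  exists (L : R) (n0 : nat), 0 < L /\
  forall n (d : 'I_n -> nat) (rho : selection_rule R d),
    graphic d -> valid_rule rho -> (n0 <= n)%N ->
    c0 * n%:R <= (\sum_i d i)%N%:R -> (\sum_i d i ^ 2)%N%:R <= C2 * n%:R ->
  1 - eps <= run_prob rho [set: graph n] /\
  forall E : {set graph n}, run_prob rho E <= L * stop_prob rho 0 E + eps.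
Proof.
move=> c0_gt0 C2_gt0 eps_gt0.
have arch (x : R) : exists k : nat, x <= k%:R.
  by exists (Num.bound `|x|); rewrite (le_trans (ler_norm x)) // ltW // archi_boundP.
have [e def_e] : exists e, eps = 5 * e by exists (eps / 5); lra.
have e_gt0 : 0 < e by lra.
have [q def_q] : exists q, q = C2 / c0 by exists (C2 / c0).
have q_gt0 : 0 < q by rewrite def_q divr_gt0.
(* [q] bounds [D2 / N], and [2 * q + 4 * q ^+ 2] the mean number of bad edges. *)
have [K leK] := arch ((2 * q + 4 * q ^+ 2) / e).
have [eta def_eta] : exists eta, eta = e / K.+1%:R by exists (e / K.+1%:R).
have eta_gt0 : 0 < eta by rewrite def_eta divr_gt0 ?ltr0n.
(* [2 * q * C2 * n] bounds the mean number of adjacent pairs. *)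
have [m lem] := arch (2 * q * C2 / e).
(* In the bound of few_bad_switchings, [r] makes the term in [D2], and [n2]
   below the remaining ones, at most half of the number allowed by [eta]. *)
have [r ler] := arch (16 * C2 / (eta * c0)).
have [n1 len1] := arch (6 / c0).
have [n2 len2] := arch (4 * (2 * r.+1 ^ 5 + 2 * r.+1 * K)%N%:R / (r.+1%:R * eta * c0)).
have [q_ge0 c0_ge0] := (ltW q_gt0, ltW c0_gt0).
pose beta0 := 2 * q + 2 * m%:R / c0 + 8 * K%:R * q.
have beta0_ge0 : 0 <= beta0.
  by rewrite /beta0 !(addr_ge0, mulr_ge0, invr_ge0) ?ler0n.
have L_gt0 : 0 < (1 + beta0) ^+ K by rewrite exprn_gt0 //; lra.
exists ((1 + beta0) ^+ K), (maxn n1 n2); split => // n d rho graphic_d valid; rewrite geq_max.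
move=> /andP[le_n1 le_n2] le_N le_D2.
have n1_le : n1%:R <= n%:R :> R by rewrite ler_nat.
have n2_le : n2%:R <= n%:R :> R by rewrite ler_nat.
have N6 : (6 <= #|{: half_edge d}|)%N.
  rewrite card_half_edge -(ler_nat R) (le_trans _ le_N) // -ler_pdivrMl // mulrC.
  exact: le_trans len1 n1_le.
have le_D2q : (\sum_i d i ^ 2)%N%:R <= q * #|{: half_edge d}|%:R.
  rewrite card_half_edge (le_trans le_D2) // def_q -mulrA ler_wpM2l ?(ltW C2_gt0) //.
  by rewrite ler_pdivlMl.
have bad_le : many_bad_prob R d K <= e.
  have := many_bad_prob_le graphic_d K N6 q_ge0 le_D2q.
  move=> /le_trans le_X; rewrite -(ler_pM2l (ltr0Sn R K)); apply: le_X.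
  rewrite ler_pdivrMr // in leK; apply: le_trans leK _.
  by rewrite ler_wpM2r ?(ltW e_gt0) // ler_nat.
have adj_le : many_adjacent_prob R d (m * n) <= e.
  have := many_adjacent_prob_le graphic_d (m * n) N6 q_ge0 le_D2q.
  move=> /le_trans le_X; rewrite -(ler_pM2l (ltr0Sn R (m * n))); apply: le_X.
  rewrite ler_pdivrMr // in lem.
  apply: (@le_trans _ _ (2 * q * (C2 * n%:R))); first by rewrite ler_wpM2l ?mulr_ge0.
  rewrite mulrA; apply: le_trans (ler_wpM2r (ler0n _ n) lem) _.
  by rewrite mulrAC -natrM ler_wpM2r ?(ltW e_gt0) // ler_nat.
have N2 := half_edges_half R (isT : 2 <= 3)%N N6.
have N_gt2 : (2 < #|{: half_edge d}|)%N by apply: leq_trans N6.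
have few C (a b : half_edge d) : C \in configurations d -> [set a; b]%SET \in C ->
  (#|bad_edges C| <= K)%N ->
  #|[set kl in switchable C (a, b) | ~~ good_switch C (a, b) kl]%SET|%:R
  <= eta * (#|{: half_edge d}| - 2)%:R.
  move=> CP abC CK; have := few_bad_switchings CP abC (ltn0Sn r).
  set x := #|_|; move=> le_x.
  have {}le_x : (r.+1 * x <= (2 * r.+1 ^ 5 + 2 * r.+1 * K) + 4 * (\sum_i d i ^ 2))%N.
    by apply: leq_trans le_x _; rewrite [leqLHS]addnAC leq_add2r leq_add2l leq_mul2l CK orbT.
  rewrite -(ler_pM2l (ltr0Sn R r)) -natrM.
  rewrite -(ler_nat R) natrD in le_x; apply: le_trans le_x _.
  set T := (_ + _)%N in len2 *; rewrite natrM.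
  have re_gt0 : 0 < r.+1%:R * eta * c0 by rewrite !mulr_gt0 ?ltr0n.
  have le_T : 4 * T%:R <= n%:R * (r.+1%:R * eta * c0).
    by rewrite -ler_pdivrMr //; apply: le_trans len2 n2_le.
  have le_r : 16 * C2 <= r.+1%:R * eta * c0.
    rewrite -mulrA -ler_pdivrMr ?mulr_gt0 //; apply: le_trans ler _.
    by rewrite ler_nat.
  have le1 : (16 * C2) * n%:R <= r.+1%:R * eta * c0 * n%:R by rewrite ler_wpM2r.
  have le2 : r.+1%:R * eta * (c0 * n%:R) <= r.+1%:R * eta * #|{: half_edge d}|%:R.
    by rewrite ler_wpM2l ?mulr_ge0 ?ler0n ?(ltW eta_gt0) // card_half_edge.
  have le3 := ler_wpM2l (mulr_ge0 (ler0n R r.+1) (ltW eta_gt0)) N2.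
  by lra.
have K_eta : K%:R * eta <= e.
  rewrite def_eta mulrCA ler_piMr ?(ltW e_gt0) // ler_pdivrMr ?ltr0Sn // mul1r.
  by rewrite ler_nat.
have likely := stop_prob_likely graphic_d valid N_gt2 (ltW eta_gt0) few.
split; first by have := stop_prob_le_run graphic_d valid K [set: graph n]; lra.
move=> E; have := run_prob_le graphic_d valid K E.
have := stop_prob_dominated (z := m * n) graphic_d valid N_gt2 (ltW eta_gt0) few E (erefl _).
set beta := _ / _.
have beta_ge0 : 0 <= beta by rewrite divr_ge0.
have le_beta : beta <= beta0.
  rewrite ler_pdivrMr ?ltr0n ?subn_gt0 // !natrD !natrM.
  have le1 : m%:R * n%:R <= m%:R / c0 * #|{: half_edge d}|%:R.
    by rewrite -mulrA ler_wpM2l // ler_pdivlMl // card_half_edge.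
  have le2 := ler_wpM2l (divr_ge0 (ler0n R m) c0_ge0) N2.
  have le3 := ler_wpM2l q_ge0 N2.
  have le4 := ler_wpM2l (ler0n R K) (le_trans le_D2q le3).
  rewrite /beta0; lra.
have le_pow : (1 + beta) ^+ K * stop_prob rho 0 E <= (1 + beta0) ^+ K * stop_prob rho 0 E.
  by apply: ler_wpM2r; [exact: stop_prob_ge0|apply: lerXn2r; rewrite ?nnegrE; lra].
by move=> dom le_run; lra.
Qed.

End Asymptotics.
(** * Contiguity *)

Section Contiguity.
Variables (R : realType) (d : forall n : nat, 'I_n -> nat).
Arguments d : clear implicits.
Variable rho : forall n : nat, selection_rule R (d n).
Arguments rho : clear implicits.
Hypothesis graphic_d : forall n, (0 < n)%N -> graphic (d n).
Hypothesis sum_d : exists c C : R, [/\ 0 < c, 0 < C &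
  \forall n \near \oo, c * n%:R <= (\sum_(i < n) d n i)%N%:R <= C * n%:R].
Hypothesis sum_d2 : exists C : R,
  \forall n \near \oo, (\sum_(i < n) d n i ^ 2)%N%:R <= C * n%:R.
Hypothesis rho_valid : forall n, (0 < n)%N -> valid_rule (rho n).

Lemma near_run_prob (eps : R) : 0 < eps -> exists2 L : R, 0 < L &
  \forall n \near \oo, 1 - eps <= run_prob (rho n) [set: graph n]%SET /\
    forall E : {set graph n}, run_prob (rho n) E <= L * stop_prob (rho n) 0 E + eps.
Proof.
move=> eps_gt0; have [c [C1 [c_gt0 _ le_d]]] := sum_d; have [C le_d2] := sum_d2.
have C_gt0 : 0 < `|C| + 1 by rewrite ltr_wpDl.
have [L [n0 [L_gt0 bounds]]] := run_prob_asymptotics c_gt0 C_gt0 eps_gt0.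
exists L => //; near=> n.
have n_gt0 : (0 < n)%N by near: n; apply: nbhs_infty_gt.
apply: bounds; [exact: graphic_d | exact: rho_valid | | | ].
- by near: n; apply: nbhs_infty_ge.
- have /andP[] // : c * n%:R <= (\sum_(i < n) d n i)%N%:R <= C1 * n%:R.
  by near: n; apply: le_d.
- apply: (@le_trans _ _ (C * n%:R)); first by near: n; apply: le_d2.
  by rewrite ler_wpM2r // (le_trans (ler_norm C)) // lerDl.
Unshelve. all: by end_near.
Qed.

(** The process ends in some graph with probability near 1, which by
    [near_run_prob] is at most a multiple of P(simple) plus a small error. *)
Lemma near_simple : exists2 p : R, 0 < p &
  \forall n \near \oo, p <= stop_prob (rho n) 0 [set: graph n]%SET.
Proof.
have [L L_gt0 bounds] := near_run_prob (divr_gt0 ltr01 (ltr0Sn R 3)).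
exists (L^-1 / 2); first by rewrite divr_gt0 ?invr_gt0.
near=> n.
have [low up] : 1 - 1 / 4 <= run_prob (rho n) [set: graph n]%SET /\
    forall E : {set graph n}, run_prob (rho n) E <= L * stop_prob (rho n) 0 E + 1 / 4.
  by near: n; apply: bounds.
by have upT := up [set: graph n]%SET; rewrite -(ler_pM2l L_gt0) mulVKf ?gt_eqF //; lra.
Unshelve. all: by end_near.
Qed.

Lemma near_valid : \forall n \near \oo, graphic (d n) /\ valid_rule (rho n).
Proof.
near=> n; have n_gt0 : (0 < n)%N by near: n; apply: nbhs_infty_gt.
by split; [apply: graphic_d|apply: rho_valid].
Unshelve. all: by end_near.
Qed.

Lemma near_run_prob_half : \forall n \near \oo, 1 / 2 <= run_prob (rho n) [set: graph n]%SET.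
Proof.
have [L _ bounds] := near_run_prob (divr_gt0 ltr01 (ltr0Sn R 1)).
near=> n; suff [] : 1 - 1 / 2 <= run_prob (rho n) [set: graph n]%SET /\
    forall E : {set graph n}, run_prob (rho n) E <= L * stop_prob (rho n) 0 E + 1 / 2.
  by move=> *; lra.
by near: n; apply: bounds.
Unshelve. all: by end_near.
Qed.

(** The runs that stop at once already give a constant fraction of the uniform
    probability. *)
Lemma uniform_le_switched (E : forall n : nat, {set graph n}) :
  switched_prob (rho n) (E n) @[n --> \oo] --> (0 : R) ->
  uniform_prob R (d n) (E n) @[n --> \oo] --> (0 : R).
Proof.
move=> /cvgr0Pnorm_lt sw0; apply/cvgr0Pnorm_lt => e e_gt0.
have [p p_gt0 simple] := near_simple.
near=> n.
have [gr va] : graphic (d n) /\ valid_rule (rho n) by near: n; apply: near_valid.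
have run_half : 1 / 2 <= run_prob (rho n) [set: graph n]%SET.
  by near: n; apply: near_run_prob_half.
have run_gt0 : 0 < run_prob (rho n) [set: graph n]%SET by lra.
have pn : p <= stop_prob (rho n) 0 [set: graph n]%SET by near: n; apply: simple.
have : `|switched_prob (rho n) (E n)| < p * e by near: n; apply: sw0; rewrite mulr_gt0.
have u_ge0 := uniform_prob_ge0 R (d n) (E n).
rewrite switched_probE // !ger0_norm ?divr_ge0 ?run_prob_ge0 //.
rewrite ltr_pdivrMr // => lt_run.
have le_run : stop_prob (rho n) 0 (E n) <= run_prob (rho n) (E n) by apply: stop_prob_le_run.
rewrite stop_prob0_uniform // in le_run.
have run_le1 := run_prob_le1 gr va [set: graph n]%SET.
rewrite -(ltr_pM2l p_gt0).
apply: le_lt_trans (ler_wpM2r u_ge0 pn) (le_lt_trans le_run (lt_le_trans lt_run _)).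
by rewrite ler_piMr // mulr_ge0 // ltW.
Unshelve. all: by end_near.
Qed.

(** For large [n] the restarts at most double the probability that one run ends
    in [E n]. *)
Lemma switched_le_uniform (E : forall n : nat, {set graph n}) :
  uniform_prob R (d n) (E n) @[n --> \oo] --> (0 : R) ->
  switched_prob (rho n) (E n) @[n --> \oo] --> (0 : R).
Proof.
move=> /cvgr0Pnorm_lt un0; apply/cvgr0Pnorm_lt => e e_gt0.
have e4_gt0 : 0 < e / 4 by rewrite divr_gt0.
have [L L_gt0 bounds] := near_run_prob e4_gt0.
near=> n.
have [gr va] : graphic (d n) /\ valid_rule (rho n) by near: n; apply: near_valid.
have run_half : 1 / 2 <= run_prob (rho n) [set: graph n]%SET.
  by near: n; apply: near_run_prob_half.
have run_gt0 : 0 < run_prob (rho n) [set: graph n]%SET by lra.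
have [_ up] : 1 - e / 4 <= run_prob (rho n) [set: graph n]%SET /\
    forall E : {set graph n}, run_prob (rho n) E <= L * stop_prob (rho n) 0 E + e / 4.
  by near: n; apply: bounds.
have : `|uniform_prob R (d n) (E n)| < e / 4 / L.
  by near: n; apply: un0; rewrite divr_gt0.
have u_ge0 := uniform_prob_ge0 R (d n) (E n).
rewrite switched_probE // !ger0_norm ?divr_ge0 ?run_prob_ge0 // ltr_pdivlMr //.
rewrite ltr_pdivrMr // => lt_u; have := up (E n); rewrite stop_prob0_uniform //.
have s_le1 := stop_prob_le1 gr va 0 [set: graph n]%SET.
have := ler_wpM2l (ltW L_gt0) (ler_wpM2r u_ge0 s_le1); rewrite mul1r => le_s le_run.
have := ler_wpM2l (ltW e_gt0) run_half; lra.
Unshelve. all: by end_near.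
Qed.

Lemma cvg_compl_prob (f g : nat -> R) (a : R) : (\forall n \near \oo, g n = 1 - f n) ->
  f n @[n --> \oo] --> a -> g n @[n --> \oo] --> 1 - a.
Proof.
move=> fg fa; have : (1 - f n) @[n --> \oo] --> 1 - a by apply: cvgB => //; apply: cvg_cst.
apply: cvg_trans; apply: near_eq_cvg; near=> n; rewrite -(near fg n) //.
Unshelve. all: by end_near.
Qed.

Lemma near_switchedC (E : forall n : nat, {set graph n}) :
  \forall n \near \oo,
    switched_prob (rho n) (~: E n)%SET = 1 - switched_prob (rho n) (E n).
Proof.
near=> n.
have [gr va] : graphic (d n) /\ valid_rule (rho n) by near: n; apply: near_valid.
apply: switched_probC => //.
have run_half : 1 / 2 <= run_prob (rho n) [set: graph n]%SET.
  by near: n; apply: near_run_prob_half.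
lra.
Unshelve. all: by end_near.
Qed.

Lemma near_uniformC (E : forall n : nat, {set graph n}) :
  \forall n \near \oo,
    uniform_prob R (d n) (~: E n)%SET = 1 - uniform_prob R (d n) (E n).
Proof.
by near=> n; apply/uniform_probC/graphic_d; near: n; apply: nbhs_infty_gt.
Unshelve. all: by end_near.
Qed.

Lemma contiguous (E : forall n : nat, {set graph n}) :
  switched_prob (rho n) (E n) @[n --> \oo] --> (0 : R) <->
  uniform_prob R (d n) (E n) @[n --> \oo] --> (0 : R).
Proof. by split; [apply: uniform_le_switched|apply: switched_le_uniform]. Qed.

End Contiguity.

Theorem theorem2p4 (R : realType) (d : forall n : nat, 'I_n -> nat)
    (rho : forall n : nat, selection_rule R (d n))
    (graphic_d : forall n, (0 < n)%N -> graphic (d n))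
    (sum_d : exists c C : R, [/\ 0 < c, 0 < C &
      \forall n \near \oo,
        c * n%:R <= (\sum_(i < n) d n i)%N%:R <= C * n%:R])
    (sum_d2 : exists C : R,
      \forall n \near \oo, (\sum_(i < n) d n i ^ 2)%N%:R <= C * n%:R)
    (rho_valid : forall n, (0 < n)%N -> valid_rule (rho n))
    (E : forall n : nat, {set graph n})
    (E_sub : forall n, (0 < n)%N -> E n \subset graphs_with_degrees (d n)) :
  ((switched_prob (rho n) (E n) @[n --> \oo] --> (0 : R)) <->
   (uniform_prob R (d n) (E n) @[n --> \oo] --> (0 : R))) /\
  ((switched_prob (rho n) (E n) @[n --> \oo] --> (1 : R)) <->
   (uniform_prob R (d n) (E n) @[n --> \oo] --> (1 : R))).
Proof.
have equiv := contiguous graphic_d sum_d sum_d2 rho_valid.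
split; first exact: equiv.
have one_compl (f g : nat -> R) : (\forall n \near \oo, g n = 1 - f n) ->
    f n @[n --> \oo] --> (1 : R) <-> g n @[n --> \oo] --> (0 : R).
  move=> fg; split=> [/(cvg_compl_prob fg)|]; first by rewrite subrr.
  move=> g0; rewrite -[1]subr0; apply: cvg_compl_prob g0.
  by apply: filterS fg => n ->; rewrite subKr.
have sw := one_compl _ _ (near_switchedC graphic_d sum_d sum_d2 rho_valid E).
have un := one_compl _ _ (near_uniformC R graphic_d E).
by rewrite sw un; apply: equiv.
Qed.
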